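(* Let $k$ be a field of characteristic $0$, $X$ a smooth scheme over $k$, and $\mathcal{A}$ a commutative $\mathcal{D}_X$-algebra. For a CY$_{\mathcal{A}}$-structure, let $\nabla^r:\mathcal{T}_{\mathcal{A}}\to\mathcal{A}$, $\nabla^r(a\tau)=a\cdot\tau$ ($a\in\mathcal A$, $\tau\in\mathcal T_X$), be the associated map, and assign to the structure the unique BV$_{\mathcal{A}}$-structure on $\Lambda^\bullet\mathcal{T}_{\mathcal{A}}$ whose component $\mathcal{T}_{\mathcal{A}}\to\mathcal{A}$ is $\nabla^r$. Conversely, to a BV$_{\mathcal{A}}$-structure assign the component $\nabla^r:\mathcal{T}_{\mathcal{A}}\to\mathcal{A}$ of its differential and the right action $a\cdot\tau:=\nabla^r(a\tau)$ of $\mathcal T_X$ on $\mathcal{A}$. These constructions are well defined and are mutually inverse bijections between the set of CY$_{\mathcal{A}}$-structures and the set of BV$_{\mathcal{A}}$-structures.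
   Context: A Gerstenhaber algebra is a $\mathbb{Z}$-graded (graded-)commutative algebra $G^\bullet$ with a bracket $[\,,]$ of degree $1$ making $G^\bullet[-1]$ (where $(G[-1])^j=G^{j-1}$) a graded Lie algebra, so in particular $[a,b]=-(-1)^{(|a|-1)(|b|-1)}[b,a]$, and such that $[a,b c]=[a,b] c+(-1)^{(|a|-1)|b|}b[a,c]$ for homogeneous $a,b,c$. A Batalin-Vilkovisky (BV) algebra is a Gerstenhaber algebra $B^\bullet$ with a differential $d$ of degree $1$ ($d^2=0$, $k$-linear) such that $(-1)^{|a|}[a,b]=d(ab)-da\cdot b-(-1)^{|a|}a\cdot db$ for all homogeneous $a,b$. A commutative $\mathcal{D}_X$-algebra is a commutative, associative, unital algebra $\mathcal{A}$ in the tensor category of left $\mathcal{D}_X$-modules quasicoherent over $\mathcal{O}_X$ (tensor product over $\mathcal{O}_X$, vector fields acting by the Leibniz rule); thus $\mathcal{T}_X$ acts on $\mathcal{A}$ by derivations, written $\tau(a)$. Put $\mathcal{T}_{\mathcal{A}}=\mathcal{A}\otimes_{\mathcal{O}_X}\mathcal{T}_X$, writing $a\tau$ for $a\otimes\tau$, with Lie bracket $[a\tau,b\tau']=a\tau(b)\tau'-b\tau'(a)\tau+ab[\tau,\tau']$ and with the $\mathcal{A}$-linear action on $\mathcal{A}$ by derivations $(a\tau)(b)=a\,\tau(b)$. $\Lambda^\bullet\mathcal{T}_{\mathcal{A}}$ is the exterior algebra over $\mathcal{A}$, with $\mathcal{A}$ in degree $0$ and $\mathcal{T}_{\mathcal{A}}$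 in degree $-1$. It is a Gerstenhaber algebra with the unique bracket of degree $1$ such that $[\tau,a]=\tau(a)$ for $a\in\mathcal{A},\tau\in\mathcal{T}_{\mathcal{A}}$ and which on $\mathcal{T}_{\mathcal{A}}$ is the Lie bracket $[a\tau,b\tau']=a\tau(b)\tau'-b\tau'(a)\tau+ab[\tau,\tau']$ ($a,b\in\mathcal{A}$, $\tau,\tau'\in\mathcal{T}_X$). $\mathcal{D}_{\mathcal{A}}$ is the sheaf of associative algebras generated by the algebra $\mathcal{A}$ and the left $\mathcal{O}_X$-module $\mathcal{T}_X$ (so $f\cdot\tau=f\tau$ for $f\in\mathcal{O}_X$), subject to $\tau\cdot a-a\cdot\tau=\tau(a)$ and $\tau\cdot\tau'-\tau'\cdot\tau=[\tau,\tau']$ for $a\in\mathcal{A}$, $\tau,\tau'\in\mathcal{T}_X$; as a left $\mathcal{A}$-module $\mathcal{D}_{\mathcal{A}}=\mathcal{A}\otimes_{\mathcal{O}_X}\mathcal{D}_X$. A CY$_{\mathcal{A}}$-structure is a right $\mathcal{D}_{\mathcal{A}}$-module structure on $\mathcal{A}$ which induces the obvious $\mathcal{A}$-module structure on $\mathcal{A}$. A BV$_{\mathcal{A}}$-structure is a differential of degree $1$ on the Gerstenhaber algebra $\Lambda^\bullet\mathcal{T}_{\mathcal{A}}$ making it a BV algebra. *)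

(* Defs.v *)
From HB Require Import structures.
From mathcomp Require Import all_boot all_order all_algebra.
From mathcomp Require Import boolp classical_sets topology.

Set Implicit Arguments.
Unset Strict Implicit.
Unset Printing Implicit Defensive.

Import GRing.Theory.
Local Open Scope classical_set_scope.
Local Open Scope ring_scope.

(* Associative unital algebras in which 1 = 0 is allowed: the library's        *)
(* algType requires 1 != 0, but sections of a sheaf of algebras over the empty *)
(* open set form the zero algebra.                                             *)
Record pzAlgType (k : fieldType) := PzAlg {
  alg_mod : lmodType k;
  alg_one : alg_mod;
  alg_mul : alg_mod -> alg_mod -> alg_mod;
  alg_mulA : associative alg_mul;
  alg_mul1l : left_id alg_one alg_mul;
  alg_mul1r : right_id alg_one alg_mul;
  alg_mulDl : left_distributive alg_mul +%R;
  alg_mulDr : right_distributive alg_mul +%R;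
  alg_scaleAl : forall (c : k) (a b : alg_mod), c *: alg_mul a b = alg_mul (c *: a) b;
  alg_scaleAr : forall (c : k) (a b : alg_mod), c *: alg_mul a b = alg_mul a (c *: b)
}.

Definition alg_sort (k : fieldType) (A : pzAlgType k) : Type := alg_mod A.
Coercion alg_sort : pzAlgType >-> Sortclass.

HB.instance Definition _ (k : fieldType) (A : pzAlgType k) :=
  GRing.Lmodule.copy (alg_sort A) (alg_mod A).
HB.instance Definition _ (k : fieldType) (A : pzAlgType k) :=
  GRing.Zmodule_isPzRing.Build (alg_sort A)
    (@alg_mulA k A) (@alg_mul1l k A) (@alg_mul1r k A) (@alg_mulDl k A) (@alg_mulDr k A).

Record is_alg_morphism (k : fieldType) (A B : pzAlgType k) (f : A -> B) : Prop := {
  alg_morphism_linear : linear f;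
  alg_morphismM : {morph f : a b / a * b};
  alg_morphism1 : f 1 = 1
}.

Definition is_bilinear (k : fieldType) (M N P : lmodType k) (f : M -> N -> P) : Prop :=
  (forall y, linear (fun x => f x y)) /\ (forall x, linear (f x)).

Record opens (X : topologicalType) := Opens {
  oset :> set X;
  oset_open : open oset
}.

(* The compatibility of the local sections s i is tested on every open set W    *)
(* contained in both V i and V j; restrictions do not depend on the inclusion   *)
(* proofs, by res_comp.                                                         *)
Record is_sheaf (X : topologicalType) (F : opens X -> Type)
    (res : forall U V : opens X, V `<=` U -> F U -> F V) : Prop := {
  res_id : forall (U : opens X) (h : U `<=` U) (s : F U), res U U h s = s;
  res_comp : forall (U V W : opens X) (h : V `<=` U) (h' : W `<=` V) (h'' : W `<=` U)
    (s : F U), res V W h' (res U V h s) = res U W h'' s;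
  sheaf_separated : forall (U : opens X) (I : Type) (V : I -> opens X)
    (VU : forall i, V i `<=` U), U `<=` \bigcup_i V i ->
    forall s t : F U, (forall i, res U (V i) (VU i) s = res U (V i) (VU i) t) -> s = t;
  sheaf_glue : forall (U : opens X) (I : Type) (V : I -> opens X)
    (VU : forall i, V i `<=` U), U `<=` \bigcup_i V i ->
    forall s : (forall i, F (V i)),
    (forall i j (W : opens X) (hi : W `<=` V i) (hj : W `<=` V j),
       res (V i) W hi (s i) = res (V j) W hj (s j)) ->
    exists t : F U, forall i, res U (V i) (VU i) t = s i
}.

Record vecSheaf (k : fieldType) (X : topologicalType) := VecSheaf {
  vsec :> opens X -> lmodType k;
  vres : forall U V : opens X, V `<=` U -> vsec U -> vsec V;
  vres_linear : forall (U V : opens X) (h : V `<=` U), linear (@vres U V h);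
  vres_sheaf : is_sheaf vres
}.
Arguments vres {k X} v {U V} _ _.

Record algSheaf (k : fieldType) (X : topologicalType) := AlgSheaf {
  asec :> opens X -> pzAlgType k;
  ares : forall U V : opens X, V `<=` U -> asec U -> asec V;
  ares_morphism : forall (U V : opens X) (h : V `<=` U), is_alg_morphism (@ares U V h);
  ares_sheaf : is_sheaf ares
}.
Arguments ares {k X} a {U V} _ _.

Definition vec_of_alg (k : fieldType) (X : topologicalType) (A : algSheaf k X) :
    vecSheaf k X :=
  VecSheaf (fun U V h => alg_morphism_linear (@ares_morphism k X A U V h)) (ares_sheaf A).
Coercion vec_of_alg : algSheaf >-> vecSheaf.

Record comAlgSheaf (k : fieldType) (X : topologicalType) := ComAlgSheaf {
  calg :> algSheaf k X;
  calgC : forall (U : opens X) (a b : calg U), a * b = b * a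
}.

Section Morphisms.
Variables (k : fieldType) (X : topologicalType).

Record is_sheaf_hom (F G : vecSheaf k X) (phi : forall U, F U -> G U) : Prop := {
  sheaf_hom_linear : forall U, linear (phi U);
  sheaf_hom_res : forall (U V : opens X) (h : V `<=` U) (s : F U),
    phi V (vres F h s) = vres G h (phi U s)
}.

Record is_alg_hom (A B : algSheaf k X) (phi : forall U, A U -> B U) : Prop := {
  alg_hom_morphism : forall U, is_alg_morphism (phi U);
  alg_hom_res : forall (U V : opens X) (h : V `<=` U) (s : A U),
    phi V (ares A h s) = ares B h (phi U s)
}.

Record is_sheaf_bilinear (F G H : vecSheaf k X) (b : forall U, F U -> G U -> H U) :
    Prop := {
  sheaf_bilinearP : forall U, is_bilinear (b U);
  sheaf_bilinear_res : forall (U V : opens X) (h : V `<=` U) (s : F U) (t : G U),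
    b V (vres F h s) (vres G h t) = vres H h (b U s t)
}.

Record module_on (A : algSheaf k X) (M : vecSheaf k X) := ModuleOn {
  msc : forall U, A U -> M U -> M U;
  msc_bilinear : @is_sheaf_bilinear A M M msc;
  msc1 : forall U (m : M U), msc 1 m = m;
  mscA : forall U (a b : A U) (m : M U), msc (a * b) m = msc a (msc b m)
}.

End Morphisms.

Section Schemes.
Variables (k : fieldType) (X : topologicalType) (O : comAlgSheaf k X).

Definition invertible_near (U : opens X) (f : O U) : set X :=
  [set x | exists (V : opens X) (h : V `<=` U), oset V x /\ exists g : O V, ares O h f * g = 1].

Lemma invertible_near_open (U : opens X) (f : O U) : open (invertible_near f).
Proof.
rewrite openE => x [V [h [Vx [g fg]]]].
apply: (@filterS _ _ _ (V : set X)); last exact: open_nbhs_nbhs (conj (oset_open V) Vx).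
by move=> y Vy; exists V, h; split=> //; exists g.
Qed.

Definition basic_open (U : opens X) (f : O U) : opens X :=
  Opens (invertible_near_open f).

Lemma basic_open_sub (U : opens X) (f : O U) : basic_open f `<=` U.
Proof. by move=> x [V [h [Vx _]]]; apply: h. Qed.

(* M(D(f)) is the localization M(U)_f of the O(U)-module M(U); here f already   *)
(* acts invertibly on M(D(f)), being a unit of O(D(f)).                         *)
Definition localizes (M : vecSheaf k X) (sc : forall U, O U -> M U -> M U)
    (U : opens X) (f : O U) : Prop :=
  (forall s : M (basic_open f), exists (n : nat) (m : M U),
     vres M (@basic_open_sub U f) m = sc _ (ares O (@basic_open_sub U f) f ^+ n) s) /\
  (forall m : M U, vres M (@basic_open_sub U f) m = 0 ->
     exists n : nat, sc _ (f ^+ n) m = 0).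

Record is_prime_ideal (R : pzAlgType k) (P : set R) : Prop := {
  prime_ideal0 : P 0;
  prime_idealD : forall a b, P a -> P b -> P (a + b);
  prime_idealM : forall a b, P b -> P (a * b);
  prime_ideal1 : ~ P 1;
  prime_idealP : forall a b, P (a * b) -> P a \/ P b
}.

(* The canonical map U -> Spec O(U), which sends x to the ideal of the          *)
(* functions on U whose germ at x is not a unit, is an isomorphism of ringed    *)
(* spaces: it is well defined, bijective, a homeomorphism (it pulls back the    *)
(* principal open sets of Spec O(U) to the basic_open f), and                   *)
(* O(basic_open f) = O(U)_f.                                                    *)
Record is_affine (U : opens X) : Prop := {
  affine_prime : forall x, oset U x -> is_prime_ideal [set f : O U | ~ oset (basic_open f) x];
  affine_point : forall P : set (O U), is_prime_ideal P ->
    exists! x, oset U x /\ P = [set f : O U | ~ oset (basic_open f) x];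
  affine_base : forall (V : opens X) x, V `<=` U -> oset V x ->
    exists f : O U, oset (basic_open f) x /\ basic_open f `<=` V;
  affine_localizes : forall f : O U,
    localizes (M := O) (fun V (g h : O V) => g * h) f
}.

Definition is_scheme : Prop := forall x : X, exists U : opens X, oset U x /\ is_affine U.

Definition finite_type (R : pzAlgType k) : Prop :=
  exists s : seq R, forall P : set R,
    (forall r, r \in s -> P r) -> P 1 ->
    (forall (c : k) a b, P a -> P b -> P (c *: a + b)) ->
    (forall a b, P a -> P b -> P (a * b)) ->
    forall r, P r.

(* Infinitesimal lifting through surjections with square-zero kernel. *)
Definition formally_smooth (R : pzAlgType k) : Prop :=
  forall (B C : pzAlgType k) (p : B -> C) (f : R -> C),
    (forall b b' : B, b * b' = b' * b) -> (forall c c' : C, c * c' = c' * c) ->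
    is_alg_morphism p -> (forall c, exists b, p b = c) ->
    (forall b b', p b = 0 -> p b' = 0 -> b * b' = 0) ->
    is_alg_morphism f ->
    exists g : R -> B, is_alg_morphism g /\ forall r, p (g r) = f r.

(* Smooth over k: locally of finite presentation and formally smooth; over a    *)
(* field finite presentation and finite type agree.                             *)
Definition is_smooth : Prop := forall x : X, exists U : opens X,
  [/\ oset U x, is_affine U, finite_type (O U) & formally_smooth (O U)].

Definition quasi_coherent (M : vecSheaf k X) (sc : forall U, O U -> M U -> M U) : Prop :=
  forall x : X, exists U : opens X,
    [/\ oset U x, is_affine U & forall f : O U, localizes sc f].

Record is_derivation (U : opens X) (D : forall V : opens X, V `<=` U -> O V -> O V) :
    Prop := {
  derivation_linear : forall (V : opens X) (h : V `<=` U), linear (D V h);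
  derivation_res : forall (V W : opens X) (hV : V `<=` U) (hW : W `<=` U)
    (h : W `<=` V) (f : O V), ares O h (D V hV f) = D W hW (ares O h f);
  derivationM : forall (V : opens X) (h : V `<=` U) (f g : O V),
    D V h (f * g) = D V h f * g + f * D V h g
}.

(* The sheaf of k-linear derivations of O, determined up to unique isomorphism  *)
(* by tan_derivation, tan_actP and tan_mscE: its sections on U are the          *)
(* derivations of the restriction of O to U.                                    *)
Record tangentSheaf := TangentSheaf {
  tan_sheaf :> vecSheaf k X;
  tan_mod : module_on O tan_sheaf;
  tan_act : forall U, tan_sheaf U -> O U -> O U;
  tan_br : forall U, tan_sheaf U -> tan_sheaf U -> tan_sheaf U;
  tan_act_bilinear : @is_sheaf_bilinear k X tan_sheaf O O tan_act;
  tan_derivation : forall U (t : tan_sheaf U),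
    is_derivation (fun V h => @tan_act V (vres tan_sheaf h t));
  tan_actP : forall U D, @is_derivation U D ->
    exists! t : tan_sheaf U, forall (V : opens X) (h : V `<=` U) (f : O V),
      tan_act (vres tan_sheaf h t) f = D V h f;
  tan_mscE : forall U (f g : O U) (t : tan_sheaf U),
    tan_act (msc tan_mod f t) g = f * tan_act t g;
  tan_brE : forall U (s t : tan_sheaf U) (f : O U),
    tan_act (tan_br s t) f = tan_act s (tan_act t f) - tan_act t (tan_act s f);
  tan_br_bilinear : is_sheaf_bilinear tan_br
}.

End Schemes.

Section DifferentialOperators.
Variables (k : fieldType) (X : topologicalType) (O : comAlgSheaf k X).
Variable T : tangentSheaf O.

Section Generated.
Variables (A : comAlgSheaf k X) (eta : forall U, O U -> A U).
Variable act : forall U, T U -> A U -> A U.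

Record is_diff_generated (D : algSheaf k X)
    (iA : forall U, A U -> D U) (iT : forall U, T U -> D U) : Prop := {
  diff_alg_hom : is_alg_hom iA;
  diff_vf_hom : @is_sheaf_hom k X T D iT;
  diff_vfZ : forall U (f : O U) (t : T U),
    iT U (msc (tan_mod T) f t) = iA U (eta f) * iT U t;
  diff_commA : forall U (t : T U) (a : A U),
    iT U t * iA U a - iA U a * iT U t = iA U (act t a);
  diff_commT : forall U (s t : T U),
    iT U s * iT U t - iT U t * iT U s = iT U (tan_br s t)
}.

(* The sheaf of algebras generated by A and T subject to the relations above,   *)
(* as a universal property.                                                     *)
Record diffAlg := DiffAlg {
  diff_sheaf :> algSheaf k X;
  diff_alg : forall U, A U -> diff_sheaf U;
  diff_vf : forall U, T U -> diff_sheaf U;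
  diff_generated : is_diff_generated diff_alg diff_vf;
  diff_universal : forall (D : algSheaf k X)
    (jA : forall U, A U -> D U) (jT : forall U, T U -> D U),
    is_diff_generated jA jT ->
    exists! phi : forall U, diff_sheaf U -> D U,
      [/\ is_alg_hom phi,
          forall U (a : A U), phi U (diff_alg a) = jA U a &
          forall U (t : T U), phi U (diff_vf t) = jT U t]
}.

End Generated.

(* D_X: on a smooth scheme in characteristic 0 the sheaf of differential        *)
(* operators is generated by O_X and T_X with the standard relations.           *)
Definition diffOps := diffAlg (fun U (f : O U) => f) (@tan_act k X O T).

Record dAlgebra (DX : diffOps) := DAlgebra {
  dalg :> comAlgSheaf k X;
  dunit : forall U, O U -> dalg U;
  dunit_hom : is_alg_hom dunit;
  dmod : module_on DX dalg;
  dmod_unit : forall U (f : O U) (a : dalg U),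
    msc dmod (diff_alg DX f) a = dunit f * a;
  dalg_quasi_coherent :
    @quasi_coherent k X O dalg (fun U (f : O U) (a : dalg U) => dunit f * a);
  vf_dalgM : forall U (t : T U) (a b : dalg U),
    msc dmod (diff_vf DX t) (a * b : dalg U) =
    (msc dmod (diff_vf DX t) a : dalg U) * b + a * (msc dmod (diff_vf DX t) b : dalg U);
  vf_dunit : forall U (t : T U) (f : O U),
    msc dmod (diff_vf DX t) (dunit f) = dunit (tan_act t f)
}.

Variables (DX : diffOps) (A : dAlgebra DX).

Definition vf_act U (t : T U) (a : A U) : A U := msc (dmod A) (diff_vf DX t) a.

Definition diffOpsOver := diffAlg (@dunit DX A) vf_act.

Definition is_balanced (N : vecSheaf k X) (b : forall U, A U -> T U -> N U) : Prop :=
  @is_sheaf_bilinear k X A T N b /\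
  forall U (a : A U) (f : O U) (t : T U),
    b U (a * dunit A f) t = b U a (msc (tan_mod T) f t).

(* The sheaf tensor product of A and T over O, as the universal O-balanced map. *)
Record tangentOver := TangentOver {
  tanA_sheaf :> vecSheaf k X;
  tanA_mod : module_on A tanA_sheaf;
  tens : forall U, A U -> T U -> tanA_sheaf U;
  tens_balanced : is_balanced tens;
  tensZ : forall U (a b : A U) (t : T U), tens (a * b) t = msc tanA_mod a (tens b t);
  tens_universal : forall (N : vecSheaf k X) (b : forall U, A U -> T U -> N U),
    is_balanced b ->
    exists! phi : forall U, tanA_sheaf U -> N U,
      is_sheaf_hom phi /\ forall U (a : A U) (t : T U), phi U (tens a t) = b U a t
}.

End DifferentialOperators.

Section Graded.
Variables (k : fieldType) (X : topologicalType).

Definition sign (i : int) : k := (-1) ^ i.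

(* In order to avoid transports, the degree of the result of an operation is a  *)
(* separate index, with a proof that it has the required value.                 *)
Record gradedAlg := GradedAlg {
  gcomp :> int -> vecSheaf k X;
  gmul : forall i j n : int, i + j = n -> forall U, gcomp i U -> gcomp j U -> gcomp n U;
  gone : forall U, gcomp 0 U;
  gmul_bilinear : forall (i j n : int) (e : i + j = n), is_sheaf_bilinear (@gmul i j n e);
  gone_res : forall (U V : opens X) (h : V `<=` U), vres (gcomp 0) h (gone U) = gone V;
  gmul1l : forall (i : int) (e : 0 + i = i) U (a : gcomp i U), gmul e (gone U) a = a;
  gmul1r : forall (i : int) (e : i + 0 = i) U (a : gcomp i U), gmul e a (gone U) = a;
  gmulA : forall (i j l ij jl n : int) (e1 : j + l = jl) (e2 : i + jl = n)
    (e3 : i + j = ij) (e4 : ij + l = n) U (a : gcomp i U) (b : gcomp j U) (c : gcomp l U),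
    gmul e2 a (gmul e1 b c) = gmul e4 (gmul e3 a b) c
}.

Record is_graded_hom (G H : gradedAlg) (phi : forall i U, G i U -> H i U) : Prop := {
  graded_hom_sheaf : forall i, is_sheaf_hom (phi i);
  graded_homM : forall (i j n : int) (e : i + j = n) U (a : G i U) (b : G j U),
    phi n U (gmul e a b) = gmul e (phi i U a) (phi j U b);
  graded_hom1 : forall U, phi 0 U (gone G U) = gone H U
}.

Record gerstenhaber (G : gradedAlg) := Gerstenhaber {
  gbr : forall i j n : int, i + j + 1 = n -> forall U, G i U -> G j U -> G n U;
  gmulC : forall (i j n : int) (e : i + j = n) (e' : j + i = n) U (a : G i U) (b : G j U),
    gmul e a b = sign (i * j) *: gmul e' b a;
  gbr_bilinear : forall (i j n : int) (e : i + j + 1 = n), is_sheaf_bilinear (@gbr i j n e);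
  gbr_antisym : forall (i j n : int) (e : i + j + 1 = n) (e' : j + i + 1 = n)
    U (a : G i U) (b : G j U),
    gbr e a b = - (sign ((i - 1) * (j - 1)) *: gbr e' b a);
  gbr_jacobi : forall (i j l ij jl il n : int)
    (e1 : j + l + 1 = jl) (e2 : i + jl + 1 = n) (e3 : i + j + 1 = ij)
    (e4 : ij + l + 1 = n) (e5 : i + l + 1 = il) (e6 : j + il + 1 = n)
    U (a : G i U) (b : G j U) (c : G l U),
    gbr e2 a (gbr e1 b c) =
    gbr e4 (gbr e3 a b) c + sign ((i - 1) * (j - 1)) *: gbr e6 b (gbr e5 a c);
  gbr_mul : forall (i j l ij jl il n : int)
    (e1 : j + l = jl) (e2 : i + jl + 1 = n) (e3 : i + j + 1 = ij)
    (e4 : ij + l = n) (e5 : i + l + 1 = il) (e6 : j + il = n)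
    U (a : G i U) (b : G j U) (c : G l U),
    gbr e2 a (gmul e1 b c) =
    gmul e4 (gbr e3 a b) c + sign ((i - 1) * j) *: gmul e6 b (gbr e5 a c)
}.

Record is_BV (G : gradedAlg) (S : gerstenhaber G)
    (d : forall i n : int, i + 1 = n -> forall U, G i U -> G n U) : Prop := {
  bv_hom : forall (i n : int) (e : i + 1 = n), is_sheaf_hom (d i n e);
  bv_square : forall (i j n : int) (e : i + 1 = j) (e' : j + 1 = n) U (a : G i U),
    d j n e' U (d i j e U a) = 0;
  bv_bracket : forall (i j i1 j1 ij n : int)
    (e : i + j + 1 = n) (e1 : i + j = ij) (e2 : ij + 1 = n)
    (e3 : i + 1 = i1) (e4 : i1 + j = n) (e5 : j + 1 = j1) (e6 : i + j1 = n)
    U (a : G i U) (b : G j U),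
    sign i *: gbr S e a b =
    d ij n e2 U (gmul e1 a b) - gmul e4 (d i i1 e3 U a) b
      - sign i *: gmul e6 a (d j j1 e5 U b)
}.

Section Exterior.
Variables (A : comAlgSheaf k X) (M : vecSheaf k X) (mM : module_on A M).

Record is_alternating (G : gradedAlg)
    (iA : forall U, A U -> G 0 U) (iM : forall U, M U -> G (-1) U) : Prop := {
  alt_alg_hom : @is_sheaf_hom k X A (G 0) iA;
  alt_algM : forall (e : 0 + 0 = 0 :> int) U (a b : A U),
    iA U (a * b) = gmul e (iA U a) (iA U b);
  alt_alg1 : forall U, iA U 1 = gone G U;
  alt_central : forall (i : int) (e : 0 + i = i) (e' : i + 0 = i) U (a : A U) (x : G i U),
    gmul e (iA U a) x = gmul e' x (iA U a);
  alt_mod_hom : is_sheaf_hom iM;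
  alt_modZ : forall (e : 0 + -1 = -1 :> int) U (a : A U) (m : M U),
    iM U (msc mM a m) = gmul e (iA U a) (iM U m);
  alt_square : forall (n : int) (e : -1 + -1 = n) U (m : M U),
    gmul e (iM U m) (iM U m) = 0
}.

(* The exterior algebra of M over A, with A in degree 0 and M in degree -1:     *)
(* the universal graded A-algebra with an A-linear map from M in degree -1      *)
(* whose values have square 0.                                                  *)
Record exteriorAlg := ExteriorAlg {
  ext_alg :> gradedAlg;
  ext_scal : forall U, A U -> ext_alg 0 U;
  ext_vec : forall U, M U -> ext_alg (-1) U;
  ext_alternating : is_alternating ext_scal ext_vec;
  ext_universal : forall (G : gradedAlg)
    (jA : forall U, A U -> G 0 U) (jM : forall U, M U -> G (-1) U),
    is_alternating jA jM ->
    exists! phi : forall i U, ext_alg i U -> G i U,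
      [/\ is_graded_hom phi,
          forall U (a : A U), phi 0 U (ext_scal a) = jA U a &
          forall U (m : M U), phi (-1) U (ext_vec m) = jM U m]
}.

End Exterior.

End Graded.

Section Structures.
Variables (k : fieldType) (X : topologicalType) (O : comAlgSheaf k X).
Variables (T : tangentSheaf O) (DX : diffOps T) (A : dAlgebra DX).
Variables (TA : tangentOver A) (L : exteriorAlg (tanA_mod TA)).

(* The Gerstenhaber structure on the exterior algebra of T_A; as T_A is         *)
(* generated by the a (x) t, the two formulas determine the bracket.            *)
Record schouten := Schouten {
  sch :> gerstenhaber L;
  sch_act : forall (e : -1 + 0 + 1 = 0 :> int) U (a b : A U) (t : T U),
    gbr sch e (ext_vec L (tens TA a t)) (ext_scal L b) = ext_scal L (a * vf_act t b);
  sch_lie : forall (e : -1 + -1 + 1 = -1 :> int) U (a b : A U) (s t : T U),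
    gbr sch e (ext_vec L (tens TA a s)) (ext_vec L (tens TA b t)) =
    ext_vec L (tens TA (a * vf_act s b) t - tens TA (b * vf_act t a) s
               + tens TA (a * b) (tan_br s t))
}.

Definition BVStructure (S : schouten) :=
  {d : forall i n : int, i + 1 = n -> forall U, L i U -> L n U | is_BV S d}.

Variable DA : diffOpsOver A.

Record is_CY (r : forall U, A U -> DA U -> A U) : Prop := {
  cy_bilinear : @is_sheaf_bilinear k X A DA A r;
  cy_one : forall U (a : A U), r U a 1 = a;
  cy_mul : forall U (a : A U) (P Q : DA U), r U a (P * Q) = r U (r U a P) Q;
  cy_alg : forall U (a b : A U), r U a (diff_alg DA b) = a * b
}.

Definition CYStructure := {r : forall U, A U -> DA U -> A U | is_CY r}.

Definition nabla_of_CY (c : CYStructure) (nabla : forall U, TA U -> A U) : Prop :=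
  @is_sheaf_hom k X TA A nabla /\
  forall U (a : A U) (t : T U), nabla U (tens TA a t) = sval c U a (diff_vf DA t).

Definition nabla_of_BV (S : schouten) (b : BVStructure S)
    (nabla : forall U, TA U -> A U) : Prop :=
  @is_sheaf_hom k X TA A nabla /\
  forall (e : -1 + 1 = 0 :> int) U (t : TA U),
    ext_scal L (nabla U t) = sval b (-1) 0 e U (ext_vec L t).

End Structures.

(* Main.v *)
(* Both kinds of structure are the same as a flat right connection, a sheaf map *)
(* nabla from T_A to A with nabla(ab t) = nabla(a t) b - a t(b) whose induced   *)
(* action of T_X respects brackets.                                             *)
(* CY: a right D_A-module structure is an algebra map from D_A to the opposite  *)
(* of the sheaf of endomorphisms of A, so it is given by its values on the      *)
(* generators.                                                                  *)
(* BV: the BV identity for d says that x |-> (x, d x) is multiplicative for a   *)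
(* product on pairs that is twisted by the bracket, so d exists and is unique   *)
(* by the universal property of the exterior algebra.  The failure of d to be   *)
(* a derivation of the bracket is itself a derivation in each argument; by      *)
(* flatness it vanishes on generators, hence everywhere, so d^2 is a            *)
(* derivation, and d^2 kills the generators for degree reasons.                 *)

Require Import Defs.
From HB Require Import structures.
From mathcomp Require Import all_boot all_order all_algebra.
From mathcomp Require Import boolp classical_sets topology.
From mathcomp Require Import zify.

Set Implicit Arguments.
Unset Strict Implicit.
Unset Printing Implicit Defensive.

Import GRing.Theory.
Local Open Scope classical_set_scope.
Local Open Scope ring_scope.

(** A right action of [DA] and a BV differential are both determined by a map [nabla] from [TA] to
    [A], and in either case the maps that occur are the flat right connections of [is_flat_right].

    For CY structures, letting the relations of [DA] act on a section of [A] gives the Leibniz rule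
    and flatness ([flat_of_CY]). Conversely these identities say that the generators of [DA] act on
    [A] with the right relations ([right_generated]), and the universal property of [DA] does the
    rest ([exists_CY_of_flat]).

    For BV structures, the BV identity for a scalar and a vector field is the Leibniz rule, since d
    of a scalar has degree 1 and vanishes. Conversely the Leibniz rule lets [nabla] extend to d by
    mapping the exterior algebra to [bv_graded] ([nabla_alternating]). The obstruction to d^2 being
    a derivation is [bv_curv] ([bv_square_mul]), itself a derivation in its second argument
    ([bv_curv_mul]), and on two vector fields it is the failure of flatness ([bv_curv_tens]). Hence
    d^2 = 0 matches flatness ([flat_of_BV], [exists_BV_of_flat]).

    As [TA] and [L] are known only by universal properties, statements about their sections are
    proved by finding a subsheaf that contains the generators ([tangentOver_ind],
    [exterior_ind]). *)

(** * Equations in abelian groups, by reflection *)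

Inductive zexpr := ZVar of nat | ZZero | ZAdd of zexpr & zexpr | ZOpp of zexpr.

Fixpoint zeval (V : zmodType) (env : seq V) (e : zexpr) : V :=
  match e with
  | ZVar n => nth 0 env n
  | ZZero => 0
  | ZAdd e1 e2 => zeval env e1 + zeval env e2
  | ZOpp e1 => - zeval env e1
  end.

Fixpoint zcoef (e : zexpr) (i : nat) : int :=
  match e with
  | ZVar n => (n == i)%:Z
  | ZZero => 0
  | ZAdd e1 e2 => zcoef e1 i + zcoef e2 i
  | ZOpp e1 => - zcoef e1 i
  end.

Lemma zevalE (V : zmodType) (env : seq V) (e : zexpr) :
  zeval env e = \sum_(i < size env) nth 0 env i *~ zcoef e i.
Proof.
elim: e => [n||e1 IH1 e2 IH2|e1 IH1] /=.
- have [lt_n|le_n] := ltnP n (size env); last first.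
    rewrite nth_default // big1 // => i _.
    by rewrite gtn_eqF ?mulr0z // (leq_trans (ltn_ord i)).
  rewrite (bigD1 (Ordinal lt_n)) //= eqxx mulr1z big1 ?addr0 // => i ne_i.
  by rewrite -val_eqE /= eq_sym in ne_i; rewrite (negbTE ne_i) mulr0z.
- by rewrite big1 // => i _; rewrite mulr0z.
- by rewrite IH1 IH2 -big_split /=; apply: eq_bigr => i _; rewrite mulrzDr.
- by rewrite IH1 -sumrN; apply: eq_bigr => i _; rewrite mulrNz.
Qed.

(** By [zevalE] a formal expression is an integer combination of its atoms, so a comparison of
    coefficients, done by computation, suffices. *)
Lemma zmod_correct (V : zmodType) (env : seq V) (e1 e2 : zexpr) :
  all (fun i => zcoef e1 i == zcoef e2 i) (iota 0 (size env)) ->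
  zeval env e1 = zeval env e2.
Proof.
move=> /allP e12; rewrite !zevalE; apply: eq_bigr => i _.
by rewrite (eqP (e12 i _)) // mem_iota ltn_ord.
Qed.

Ltac zmod_index x env :=
  match env with
  | ?y :: _ => let _ := match goal with _ => unify x y end in constr:(O)
  | _ :: ?env' => let n := zmod_index x env' in constr:(S n)
  end.
Ltac zmod_add x env :=
  match env with
  | _ => let n := zmod_index x env in env
  | _ => constr:(x :: env)
  end.
Ltac zmod_env t env :=
  lazymatch t with
  | @GRing.add _ ?a ?b => let env' := zmod_env a env in zmod_env b env'
  | @GRing.opp _ ?a => zmod_env a env
  | @GRing.zero _ => env
  | _ => zmod_add t env
  end.
Ltac zmod_quote t env :=
  lazymatch t with
  | @GRing.add _ ?a ?b =>
      let a' := zmod_quote a env in let b' := zmod_quote b env in constr:(ZAdd a' b')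
  | @GRing.opp _ ?a => let a' := zmod_quote a env in constr:(ZOpp a')
  | @GRing.zero _ => constr:(ZZero)
  | _ => let n := zmod_index t env in constr:(ZVar n)
  end.
(* Decides equations that hold in every abelian group. *)
Ltac zmod :=
  lazymatch goal with
  | |- @eq ?V ?l ?r =>
      let env := zmod_env l (@nil V) in
      let env := zmod_env r env in
      let l' := zmod_quote l env in
      let r' := zmod_quote r env in
      exact: (@zmod_correct _ env l' r' isT)
  end.

(** * Linear maps and signs *)

Section Linear.
Variables (k : fieldType) (M N P : lmodType k).

Lemma linear_add (f : M -> N) : linear f -> {morph f : x y / x + y}.
Proof. by move=> lf x y; have := lf 1 x y; rewrite !scale1r. Qed.

Lemma linear_zero (f : M -> N) : linear f -> f 0 = 0.
Proof. by move=> lf; apply: (addIr (f 0)); rewrite -linear_add // !add0r. Qed.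

Lemma linear_scale (f : M -> N) : linear f -> forall c : k, {morph f : x / c *: x}.
Proof. by move=> lf c x; have := lf c x 0; rewrite linear_zero // !addr0. Qed.

Lemma linear_opp (f : M -> N) : linear f -> {morph f : x / - x}.
Proof. by move=> lf x; rewrite -!scaleN1r linear_scale. Qed.

Lemma linear_sub (f : M -> N) : linear f -> {morph f : x y / x - y}.
Proof. by move=> lf x y; rewrite linear_add // linear_opp. Qed.

End Linear.

Section Sign.
Variable k : fieldType.

Definition oddz (i : int) : bool := odd `|i|.

Lemma oddzD (i j : int) : oddz (i + j) = oddz i (+) oddz j.
Proof. rewrite /oddz; lia. Qed.
Lemma oddzN (i : int) : oddz (- i) = oddz i.
Proof. by rewrite /oddz abszN. Qed.
Lemma oddzM (i j : int) : oddz (i * j) = oddz i && oddz j.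
Proof. by rewrite /oddz abszM oddM. Qed.

(** A negative exponent gives an inverse, but -1 is its own inverse, so only the parity matters and
    sign identities become Boolean case analyses. *)
Lemma signE (i : int) : sign k i = (-1) ^+ oddz i.
Proof.
by rewrite /sign /oddz signr_odd; case: i => n //=; rewrite -invr_sign.
Qed.

End Sign.

Definition signP := (signE, oddzD, oddzM, oddzN).
(* Decides equations whose coefficients are signs depending on i, j and l. *)
Ltac sign_zmod i j l :=
  rewrite ?signP; case: (oddz i); case: (oddz j); case: (oddz l); rewrite /= ?(expr0, expr1, mul1r, mulr1, mulN1r, mulrN1, opprK, scale1r, scaleN1r); zmod.

(** * Sheaf maps and subsheaves *)

Section SheafMaps.
Variables (k : fieldType) (X : topologicalType).
Implicit Types F G H : vecSheaf k X.

Lemma hom_id F : is_sheaf_hom (fun U (x : F U) => x).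
Proof. by []. Qed.

Lemma hom_comp F G H (f : forall U, F U -> G U) (g : forall U, G U -> H U) :
  is_sheaf_hom f -> is_sheaf_hom g -> is_sheaf_hom (fun U x => g U (f U x)).
Proof.
move=> [lf rf] [lg rg]; split=> [U c x y|U V h s]; first by rewrite lf lg.
by rewrite rf rg.
Qed.

Lemma hom_scale F G (c : k) (f : forall U, F U -> G U) :
  is_sheaf_hom f -> is_sheaf_hom (fun U x => c *: f U x).
Proof.
move=> [lf rf]; split=> [U a x y|U V h s].
  by rewrite lf scalerDr !scalerA mulrC.
by rewrite rf (linear_scale (vres_linear h)).
Qed.

Lemma hom_sub F G (f g : forall U, F U -> G U) :
  is_sheaf_hom f -> is_sheaf_hom g -> is_sheaf_hom (fun U x => f U x - g U x).
Proof.
move=> [lf rf] [lg rg]; split=> [U a x y|U V h s].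
  by rewrite lf lg scalerBr; zmod.
by rewrite rf rg (linear_sub (vres_linear h)).
Qed.

Lemma bilinear_flip F G H (b : forall U, F U -> G U -> H U) :
  is_sheaf_bilinear b -> is_sheaf_bilinear (fun U y x => b U x y).
Proof.
move=> [lb rb]; split=> [U|U V h s t]; last exact: rb.
by have [bl br] := lb U; split.
Qed.

Lemma bilinear_hom F G H H' (b : forall U, F U -> G U -> H U) (f : forall U, H U -> H' U) :
  is_sheaf_bilinear b -> is_sheaf_hom f -> is_sheaf_bilinear (fun U x y => f U (b U x y)).
Proof.
move=> [lb rb] [lf rf]; split=> [U|U V h s t]; last by rewrite rb rf.
have [bl br] := lb U; split=> [y|x] c s t; first by rewrite bl lf.
by rewrite br lf.
Qed.

Lemma bilinear_homl F F' G H (b : forall U, F U -> G U -> H U) (f : forall U, F' U -> F U) :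
  is_sheaf_bilinear b -> is_sheaf_hom f -> is_sheaf_bilinear (fun U x y => b U (f U x) y).
Proof.
move=> [lb rb] [lf rf]; split=> [U|U V h s t]; last by rewrite rf rb.
by have [bl br] := lb U; split=> [y|x] c s t; rewrite ?lf ?bl ?br.
Qed.

Lemma bilinear_homr F G G' H (b : forall U, F U -> G U -> H U) (f : forall U, G' U -> G U) :
  is_sheaf_bilinear b -> is_sheaf_hom f -> is_sheaf_bilinear (fun U x y => b U x (f U y)).
Proof.
by move=> bb ff; apply/bilinear_flip/(bilinear_homl (bilinear_flip bb) ff).
Qed.

Lemma bilinear_sub F G H (b b' : forall U, F U -> G U -> H U) :
  is_sheaf_bilinear b -> is_sheaf_bilinear b' ->
  is_sheaf_bilinear (fun U x y => b U x y - b' U x y).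
Proof.
move=> [lb rb] [lb' rb']; split=> [U|U V h s t].
  have [bl br] := lb U; have [bl' br'] := lb' U.
  by split=> [y|x] c s t; rewrite ?bl ?bl' ?br ?br' scalerBr; zmod.
by rewrite rb rb' (linear_sub (vres_linear h)).
Qed.

Lemma bilinear_scale F G H (c : k) (b : forall U, F U -> G U -> H U) :
  is_sheaf_bilinear b -> is_sheaf_bilinear (fun U x y => c *: b U x y).
Proof. by move=> bb; apply: (bilinear_hom bb (hom_scale c (hom_id H))). Qed.

Lemma bilinear_add F G H (b b' : forall U, F U -> G U -> H U) :
  is_sheaf_bilinear b -> is_sheaf_bilinear b' ->
  is_sheaf_bilinear (fun U x y => b U x y + b' U x y).
Proof.
move=> [lb rb] [lb' rb']; split=> [U|U V h s t].
  have [bl br] := lb U; have [bl' br'] := lb' U.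
  by split=> [y|x] c s t; rewrite ?bl ?bl' ?br ?br' scalerDr; zmod.
by rewrite rb rb' (linear_add (vres_linear h)).
Qed.

Section HomTheory.
Variables (F G : vecSheaf k X) (f : forall U, F U -> G U) (hf : is_sheaf_hom f).

Lemma hom_zero U : @f U 0 = 0.
Proof. by apply: linear_zero; apply: sheaf_hom_linear. Qed.
Lemma hom_lin U (c : k) (x y : F U) : @f U (c *: x + y) = c *: @f U x + @f U y.
Proof. exact: (sheaf_hom_linear hf). Qed.
Lemma hom_addE U (x y : F U) : @f U (x + y) = @f U x + @f U y.
Proof. by apply: linear_add; apply: sheaf_hom_linear. Qed.
Lemma hom_oppE U (x : F U) : @f U (- x) = - @f U x.
Proof. by apply: linear_opp; apply: sheaf_hom_linear. Qed.
Lemma hom_scaleE U (c : k) (x : F U) : @f U (c *: x) = c *: @f U x.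
Proof. by apply: linear_scale; apply: sheaf_hom_linear. Qed.
End HomTheory.

Section BilinearTheory.
Variables (F G H : vecSheaf k X) (b : forall U, F U -> G U -> H U).
Hypothesis bb : is_sheaf_bilinear b.

Lemma bil_linl U (y : G U) : linear (fun x => @b U x y).
Proof. by case: bb => /(_ U)[]. Qed.
Lemma bil_linr U (x : F U) : linear (@b U x).
Proof. by case: bb => /(_ U)[]. Qed.
Lemma bil0l U (y : G U) : @b U 0 y = 0.
Proof. exact: linear_zero (bil_linl y). Qed.
Lemma bil0r U (x : F U) : @b U x 0 = 0.
Proof. exact: linear_zero (bil_linr x). Qed.
Lemma bilDl U (x x' : F U) (y : G U) : @b U (x + x') y = @b U x y + @b U x' y.
Proof. exact: linear_add (bil_linl y) _ _. Qed.
Lemma bilDr U (x : F U) (y y' : G U) : @b U x (y + y') = @b U x y + @b U x y'.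
Proof. exact: linear_add (bil_linr x) _ _. Qed.
Lemma bilNl U (x : F U) (y : G U) : @b U (- x) y = - @b U x y.
Proof. exact: linear_opp (bil_linl y) _. Qed.
Lemma bilNr U (x : F U) (y : G U) : @b U x (- y) = - @b U x y.
Proof. exact: linear_opp (bil_linr x) _. Qed.
Lemma bilZl U (c : k) (x : F U) (y : G U) : @b U (c *: x) y = c *: @b U x y.
Proof. exact: linear_scale (bil_linl y) _ _. Qed.
Lemma bilZr U (c : k) (x : F U) (y : G U) : @b U x (c *: y) = c *: @b U x y.
Proof. exact: linear_scale (bil_linr x) _ _. Qed.
End BilinearTheory.

End SheafMaps.

(** * Subsheaves, kernels and annihilators *)

Section Subsheaf.
Variables (k : fieldType) (X : topologicalType).

(** These are the admissible induction predicates on sections; [sub_pred_local] is what makes the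
    sections satisfying the predicate glue. *)
Record subsheaf (F : vecSheaf k X) := Subsheaf {
  sub_pred :> forall U, F U -> Prop;
  sub_pred0 : forall U, sub_pred (0 : F U);
  sub_predP : forall U (c : k) (x y : F U),
    sub_pred x -> sub_pred y -> sub_pred (c *: x + y);
  sub_pred_res : forall (U V : opens X) (h : V `<=` U) (x : F U),
    sub_pred x -> sub_pred (vres F h x);
  sub_pred_local : forall (U : opens X) (I : Type) (V : I -> opens X)
    (VU : forall i, V i `<=` U), U `<=` \bigcup_i V i ->
    forall x : F U, (forall i, sub_pred (vres F (VU i) x)) -> sub_pred x
}.

Variables (F : vecSheaf k X) (P : subsheaf F).

Definition sub_mem (U : opens X) : {pred F U} := fun x => `[<P U x>].

Lemma sub_memP U (x : F U) : reflect (P U x) (x \in @sub_mem U).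
Proof. exact: asboolP. Qed.

Lemma sub_mem_closed U : submod_closed (@sub_mem U).
Proof.
split=> [|c x y /sub_memP Px /sub_memP Py]; first exact/sub_memP/sub_pred0.
exact/sub_memP/sub_predP.
Qed.

HB.instance Definition _ U := GRing.isSubmodClosed.Build k (F U) (@sub_mem U) (sub_mem_closed U).

Record sub_sec (U : opens X) := SubSec { sub_val : F U; _ : sub_val \in @sub_mem U }.

HB.instance Definition _ U := [isSub for @sub_val U].
HB.instance Definition _ U := [Choice of sub_sec U by <:].
HB.instance Definition _ U := [SubChoice_isSubLmodule of sub_sec U by <:].

Lemma sub_valP U (x : sub_sec U) : P U (sub_val x).
Proof. by case: x => x /= /sub_memP. Qed.

Definition mk_sub U (x : F U) (Px : P U x) : sub_sec U := SubSec (introT (sub_memP x) Px).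

Definition sub_res (U V : opens X) (h : V `<=` U) (x : sub_sec U) : sub_sec V :=
  mk_sub (sub_pred_res h (sub_valP x)).

Lemma sub_res_linear (U V : opens X) (h : V `<=` U) : linear (sub_res h).
Proof. by move=> c x y; apply: val_inj; rewrite /= (vres_linear h). Qed.

Lemma sub_is_sheaf : is_sheaf sub_res.
Proof.
have [Fid Fcomp Fsep Fglue] := vres_sheaf F.
split=> [U h s|U V W h h' h'' s|U I V VU cov s t st|U I V VU cov s agree].
- by apply: val_inj; apply: Fid.
- by apply: val_inj; apply: Fcomp.
- apply: val_inj; apply: (Fsep U I V VU cov) => i.
  by have /(congr1 val) := st i.
- have [|t tE] := Fglue U I V VU cov (fun i => val (s i)).
    by move=> i j W hi hj; have /(congr1 val) := agree i j W hi hj.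
  have Pt : P U t by apply: (sub_pred_local cov) => i; rewrite tE; apply: sub_valP.
  by exists (mk_sub Pt) => i; apply: val_inj; apply: tE.
Qed.

Definition sub_sheaf : vecSheaf k X :=
  @VecSheaf k X (fun U => sub_sec U) sub_res sub_res_linear sub_is_sheaf.

Lemma hom_sub_val : @is_sheaf_hom k X sub_sheaf F sub_val.
Proof. by []. Qed.

End Subsheaf.

Section SubsheafExamples.
Variables (k : fieldType) (X : topologicalType) (F : vecSheaf k X).

(** Besides indexing a family, [I] can be a proposition such as [0 < i]; the condition is then
    imposed only in the degrees where it holds. *)
Definition kernel (I : Type) (G : vecSheaf k X) (f : I -> forall U, F U -> G U)
  (hf : forall i, is_sheaf_hom (f i)) : subsheaf F.
Proof.
refine (@Subsheaf k X F (fun U x => forall i, f i U x = 0) _ _ _ _).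
- by move=> U i; rewrite (hom_zero (hf i)).
- by move=> U c x y x0 y0 i; rewrite (hom_lin (hf i)) x0 y0 scaler0 addr0.
- by move=> U V h x x0 i; rewrite (sheaf_hom_res (hf i)) x0 (linear_zero (vres_linear h)).
- move=> U J V VU cov x x0 i; apply: (sheaf_separated (vres_sheaf G) cov) => j.
  by rewrite -(sheaf_hom_res (hf i)) x0 (linear_zero (vres_linear _)).
Defined.

Section Annihilator.
Variables (I : opens X -> Type) (ires : forall U V : opens X, V `<=` U -> I U -> I V).
Variables (H : vecSheaf k X) (b : forall U, F U -> I U -> H U).
Hypothesis b_linear : forall U (y : I U), linear (fun x => b x y).
Hypothesis b_res : forall (U V : opens X) (h : V `<=` U) (x : F U) (y : I U),
  b (vres F h x) (ires h y) = vres H h (b x y).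

(** A parameter on a smaller open set need not extend to [U], so all parameters on all smaller open
    sets are tested; this makes the condition stable under restriction. *)
Definition annihilator : subsheaf F.
Proof.
refine (@Subsheaf k X F
  (fun U x => forall (V : opens X) (h : V `<=` U) (y : I V), b (vres F h x) y = 0) _ _ _ _).
- by move=> U V h y; rewrite (linear_zero (vres_linear h)) (linear_zero (b_linear y)).
- move=> U c x y x0 y0 V h z; rewrite (vres_linear h).
  by rewrite b_linear x0 y0 scaler0 addr0.
- move=> U V h x x0 W h' y.
  by rewrite (res_comp (vres_sheaf F) _ _ (subset_trans h' h)).
- move=> U J V VU cov x x0 W h y.
  (* The parameter [y] lives on [W] only, so the vanishing is checked on the cover of [W] by its
     intersections with the [V i]. *)
  pose VW i : opens X := Opens (openI (oset_open (V i)) (oset_open W)).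
  have VWW i : VW i `<=` W by move=> z [].
  have VWV i : VW i `<=` V i by move=> z [].
  apply: (@sheaf_separated _ _ _ (vres_sheaf H) W J VW VWW).
    by move=> z Wz; have [i _ Vz] := cov z (h z Wz); exists i.
  move=> i; rewrite (linear_zero (vres_linear _)) -b_res.
  rewrite (res_comp (vres_sheaf F) _ _ (subset_trans (VWV i) (VU i))).
  by rewrite -(res_comp (vres_sheaf F) (VU i) (VWV i)) x0.
Defined.

Lemma annihilatorP U (x : F U) : annihilator U x -> forall y, b x y = 0.
Proof.
by move=> x0 y; have := x0 U (@subset_refl _ U) y; rewrite (res_id (vres_sheaf F)).
Qed.

End Annihilator.

End SubsheafExamples.

(** * Generation of the tensor product and of the exterior algebra *)

Section TangentOver.
Variables (k : fieldType) (X : topologicalType) (O : comAlgSheaf k X).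
Variables (T : tangentSheaf O) (DX : diffOps T) (A : dAlgebra DX) (TA : tangentOver A).

(* Corestricting the universal balanced map to a subsheaf P and composing with *)
(* the inclusion of P gives an endomorphism of TA that fixes all a (x) t.       *)
Lemma tangentOver_ind (P : subsheaf TA) :
  (forall U (a : A U) (t : T U), P U (tens TA a t)) -> forall U (x : TA U), P U x.
Proof.
move=> Pt.
pose b U (a : A U) (t : T U) : sub_sheaf P U := mk_sub (Pt U a t).
have [[tens_lin tens_res] tens_bal] := tens_balanced TA.
have bb : is_balanced b.
  split; first split=> [U|U V h a t].
  - by have [tl tr] := tens_lin U; split=> [t|a] c x y; apply: val_inj; rewrite /= ?tl ?tr.
  - by apply: val_inj; apply: tens_res.
  - by move=> U a f t; apply: val_inj; apply: tens_bal.
have [phi [[phi_hom phiE] _]] := tens_universal TA bb.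
have [psi [_ psi_uniq]] := tens_universal TA (tens_balanced TA).
have psi_id : psi = fun U x => x by apply: psi_uniq; split=> //; apply: hom_id.
have psi_phi : psi = fun U x => sub_val (phi U x).
  apply: psi_uniq; split; first exact: hom_comp phi_hom (hom_sub_val P).
  by move=> U a t; rewrite phiE.
move=> U x; have -> : x = sub_val (phi U x) by rewrite -[LHS]/((fun U x => x) U x) -psi_id psi_phi.
exact: sub_valP.
Qed.

(** The parameters form a mere family of types with restriction maps, so that they may be pairs in
    which nothing is linear; [bv_curv_vec] relies on this. *)
Lemma tangentOver_family_zero (I : opens X -> Type)
    (ires : forall U V : opens X, V `<=` U -> I U -> I V)
    (H : vecSheaf k X) (b : forall U, TA U -> I U -> H U) :
  (forall U (y : I U), linear (fun x => b U x y)) ->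
  (forall (U V : opens X) (h : V `<=` U) (x : TA U) (y : I U),
     b V (vres TA h x) (ires U V h y) = vres H h (b U x y)) ->
  (forall U (a : A U) (t : T U) y, b U (tens TA a t) y = 0) ->
  forall U x y, b U x y = 0.
Proof.
move=> bl br b0 U x; apply: (annihilatorP (b_linear := bl) (b_res := br)).
apply: tangentOver_ind => {x}U a t V h y.
by rewrite -(sheaf_bilinear_res (tens_balanced TA).1) b0.
Qed.

Lemma tangentOver_bilinear_eq (F H : vecSheaf k X) (b b' : forall U, TA U -> F U -> H U) :
  is_sheaf_bilinear b -> is_sheaf_bilinear b' ->
  (forall U (a : A U) (t : T U) y, b U (tens TA a t) y = b' U (tens TA a t) y) ->
  forall U x y, b U x y = b' U x y.
Proof.
move=> bb bb' bE U x y; apply/eqP; rewrite -subr_eq0; apply/eqP.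
have [bl br] := bilinear_sub bb bb'.
by apply: (tangentOver_family_zero (fun U => (bl U).1) br) => *; rewrite bE subrr.
Qed.

Lemma tangentOver_hom_eq (H : vecSheaf k X) (f g : forall U, TA U -> H U) :
  is_sheaf_hom f -> is_sheaf_hom g ->
  (forall U (a : A U) (t : T U), f U (tens TA a t) = g U (tens TA a t)) -> f = g.
Proof.
move=> hf hg fg; apply: functional_extensionality_dep => U; apply: funext => x.
apply/eqP; rewrite -subr_eq0; apply/eqP.
apply: (tangentOver_ind (P := kernel (fun _ : unit => hom_sub hf hg)) _ x tt) => {x}U a t _.
by rewrite fg subrr.
Qed.

End TangentOver.

Section Exterior.
Variables (k : fieldType) (X : topologicalType) (A : comAlgSheaf k X).
Variables (M : vecSheaf k X) (mM : module_on A M) (L : exteriorAlg mM).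

Section Induction.
Variable P : forall i, subsheaf (L i).
Hypothesis P_scal : forall U (a : A U), P 0 U (ext_scal L a).
Hypothesis P_vec : forall U (m : M U), P (-1) U (ext_vec L m).
Hypothesis P_mul : forall (i j n : int) (e : i + j = n) U (x : L i U) (y : L j U),
  P i U x -> P j U y -> P n U (gmul e x y).

Let P_one U : P 0 U (gone L U).
Proof. by rewrite -(alt_alg1 (ext_alternating L)). Qed.

Let sub_mul (i j n : int) (e : i + j = n) U (x : sub_sheaf (P i) U) (y : sub_sheaf (P j) U) :
  sub_sheaf (P n) U := mk_sub (P_mul e (sub_valP x) (sub_valP y)).

Definition sub_graded : gradedAlg k X.
Proof.
refine (@GradedAlg k X (fun i => sub_sheaf (P i)) sub_mul (fun U => mk_sub (@P_one U))
  _ _ _ _ _).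
- move=> i j n e; split=> [U|U V h x y]; last first.
    by apply: val_inj; rewrite /= (sheaf_bilinear_res (gmul_bilinear L e)).
  split=> [y|x] c s t; apply: val_inj.
    by rewrite /= (bilDl (gmul_bilinear L e)) (bilZl (gmul_bilinear L e)).
  by rewrite /= (bilDr (gmul_bilinear L e)) (bilZr (gmul_bilinear L e)).
- by move=> U V h; apply: val_inj; apply: gone_res.
- by move=> i e U a; apply: val_inj; apply: gmul1l.
- by move=> i e U a; apply: val_inj; apply: gmul1r.
- by move=> *; apply: val_inj; apply: gmulA.
Defined.

(** The universal map into the graded subalgebra cut out by [P], followed by the inclusion, fixes
    the generators; by uniqueness it is the identity. *)
Lemma exterior_ind i U (x : L i U) : P i U x.
Proof.
have altL := ext_alternating L; have [aA aM a1 aC aV aZ asq] := altL.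
have altS : @is_alternating _ _ _ _ mM sub_graded
    (fun U a => mk_sub (@P_scal U a)) (fun U m => mk_sub (@P_vec U m)).
  split.
  - by case: aA => al ar; split=> [V c a b|V W h a]; apply: val_inj; rewrite /= ?al ?ar.
  - by move=> *; apply: val_inj; apply: aM.
  - by move=> *; apply: val_inj; apply: a1.
  - by move=> *; apply: val_inj; apply: aC.
  - by case: aV => al ar; split=> [V c a b|V W h a]; apply: val_inj; rewrite /= ?al ?ar.
  - by move=> *; apply: val_inj; apply: aZ.
  - by move=> *; apply: val_inj; apply: asq.
have [phi [[[phi_hom phiM phi1] phiA phiV] _]] := ext_universal L altS.
have [psi [_ psi_uniq]] := ext_universal L altL.
have psi_id : psi = fun i U x => x by apply: psi_uniq; split.
have psi_phi : psi = fun i U x => sub_val (phi i U x).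
  apply: psi_uniq; split=> [|V a|V m]; last 2 first.
  - by rewrite phiA.
  - by rewrite phiV.
  split=> [j|j l n e V a b|V].
  - exact: hom_comp (phi_hom j) (hom_sub_val (P j)).
  - by rewrite phiM.
  - by rewrite phi1.
have -> : x = sub_val (phi i U x).
  by rewrite -[LHS]/((fun i U x => x) i U x) -psi_id psi_phi.
exact: sub_valP.
Qed.

End Induction.

(** The Laurent polynomials over [A] in a variable of degree 1: a copy of [A] in every degree avoids
    case analysis on the degree. It serves as target of the map that kills [M], which splits
    [ext_scal]. *)
Definition const_graded : gradedAlg k X.
Proof.
refine (@GradedAlg k X (fun=> A) (fun _ _ _ _ U (a b : A U) => a * b) (fun U => 1) _ _ _ _ _).
- move=> i j n _; split=> [U|U V h x y].
    split=> [y|x] c s t; rewrite ?mulrDl ?mulrDr.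
      by congr (_ + _); apply/esym/alg_scaleAl.
    by congr (_ + _); apply/esym/alg_scaleAr.
  by rewrite /= (alg_morphismM (ares_morphism A h)).
- by move=> U V h; apply: (alg_morphism1 (ares_morphism A h)).
- by move=> i _ U a; apply: mul1r.
- by move=> i _ U a; apply: mulr1.
- by move=> *; apply: mulrA.
Defined.

Lemma exterior_augmentation :
  exists eps : forall i U, L i U -> A U,
    [/\ forall i, @is_sheaf_hom k X (L i) A (eps i),
        forall (i j n : int) (e : i + j = n) U (x : L i U) (y : L j U),
          eps n U (gmul e x y) = eps i U x * eps j U y
      & forall U (a : A U), eps 0 U (ext_scal L a) = a].
Proof.
have alt0 : @is_alternating _ _ _ _ mM const_graded (fun U a => a) (fun U m => 0).
  split=> //.
  - by move=> *; apply: calgC.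
  - split=> [U c a b|U V h s]; first by rewrite scaler0 addr0.
    by rewrite (linear_zero (vres_linear _)).
  - by move=> e U a m; apply/esym/mulr0.
  - by move=> n e U m; apply: mulr0.
have [phi [[[phi_hom phiM phi1] phiA phiV] _]] := ext_universal L alt0.
by exists phi.
Qed.

(** The generators have degree 0 or -1, and a product of positive degree has a factor of positive
    degree. *)
Lemma exterior_pos i U (x : L i U) : 0 < i -> x = 0.
Proof.
move: i U x; apply: (exterior_ind (P := fun i => kernel (fun _ : 0 < i => hom_id (L i)))) => //.
move=> i j n e U x y x0 y0 /= n0.
have [/x0 /= ->|i0] := boolP (0 < i); first by rewrite (bil0l (gmul_bilinear L e)).
have [/y0 /= ->|j0] := boolP (0 < j); first by rewrite (bil0r (gmul_bilinear L e)).
lia.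
Qed.

Lemma exterior_scal_iso :
  exists rho : forall U, L 0 U -> A U,
    [/\ @is_sheaf_hom k X (L 0) A rho, forall U (a : A U), rho U (ext_scal L a) = a
      & forall U (x : L 0 U), ext_scal L (rho U x) = x].
Proof.
have [eps [eps_hom epsM epsA]] := exterior_augmentation.
exists (eps 0); split=> // U x.
have [aA aM a1 _ _ _ _] := ext_alternating L.
(* Induction needs a statement in every degree [i]. Multiplying by the unit along [e] moves a scalar
   to degree [i], and the statement is void unless [i] is 0. *)
have hom_h i (e : 0 + 0 = i) : @is_sheaf_hom k X (L i) (L i)
    (fun U x => gmul e (ext_scal L (eps i U x)) (gone L U) - x).
  apply: hom_sub (hom_id _).
  have [lA rA] := hom_comp (eps_hom i) aA.
  split=> [V c y z|V W h y].
    by rewrite lA (bilDl (gmul_bilinear L e)) (bilZl (gmul_bilinear L e)).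
  by rewrite rA -(gone_res L h) (sheaf_bilinear_res (gmul_bilinear L e)).
suff /(_ 0 U x (addr0 0)) : forall i U (x : L i U), kernel (hom_h i) U x.
  by rewrite /= gmul1r => /eqP; rewrite subr_eq0 => /eqP.
apply: exterior_ind => {x}[V a e|V m e|i j n e V x y Px Py e'].
- by rewrite /= epsA gmul1r subrr.
- by [].
have [i0|i0] := boolP (0 < i).
  rewrite (exterior_pos x i0) (bil0l (gmul_bilinear L e)).
  exact: (hom_zero (hom_h n e')).
have [j0|j0] := boolP (0 < j).
  rewrite (exterior_pos y j0) (bil0r (gmul_bilinear L e)).
  exact: (hom_zero (hom_h n e')).
have i_eq0 : i = 0 by lia.
have j_eq0 : j = 0 by lia.
subst i j n; rewrite (eq_irrelevance e' erefl) => {e'}.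
move: Px Py => /(_ (addr0 0)) /eqP; rewrite gmul1r subr_eq0 => /eqP xE.
move=> /(_ (addr0 0)) /eqP; rewrite gmul1r subr_eq0 => /eqP yE.
by rewrite /= epsM (aM erefl) xE yE gmul1r; apply: subrr.
Qed.

End Exterior.

(** * The sheaf of endomorphisms *)

Section Endomorphisms.
Variables (k : fieldType) (X : topologicalType) (E : vecSheaf k X).

(** A section over [U] of the sheaf of endomorphisms of [E]. The values on all smaller open sets are
    part of the data, because a linear map of [E U] alone does not restrict. *)
Record endo (U : opens X) := Endo {
  endo_fun : forall V : opens X, V `<=` U -> E V -> E V;
  endo_linear : forall (V : opens X) (h : V `<=` U), linear (endo_fun h);
  endo_fun_res : forall (V W : opens X) (hV : V `<=` U) (hW : W `<=` U) (h : W `<=` V) (s : E V),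
    vres E h (endo_fun hV s) = endo_fun hW (vres E h s)
}.

Lemma endo_eq U (f g : endo U) :
  (forall (V : opens X) (h : V `<=` U) s, endo_fun f h s = endo_fun g h s) -> f = g.
Proof.
case: f g => [f lf rf] [g lg rg] /= fg.
have fg' : f = g.
  do 2! [apply: functional_extensionality_dep => ?].
  by apply: funext => s; apply: fg.
by subst g; congr Endo; apply: Prop_irrelevance.
Qed.

Section Module.
Variable U : opens X.
Implicit Types f g : endo U.

HB.instance Definition _ := gen_eqMixin (endo U).
HB.instance Definition _ := gen_choiceMixin (endo U).

Definition endo_zero : endo U.
Proof.
refine (@Endo U (fun V h s => 0) _ _) => [V h c s t|V W hV hW h s].
  by rewrite scaler0 addr0.
exact: linear_zero (vres_linear h).
Defined.

Definition endo_opp f : endo U.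
Proof.
refine (@Endo U (fun V h s => - endo_fun f h s) _ _) => [V h c s t|V W hV hW h s].
  by rewrite endo_linear scalerN opprD.
by rewrite (linear_opp (vres_linear h)) (endo_fun_res f hV hW).
Defined.

Definition endo_add f g : endo U.
Proof.
refine (@Endo U (fun V h s => endo_fun f h s + endo_fun g h s) _ _) => [V h c s t|V W hV hW h s].
  by rewrite !endo_linear scalerDr; zmod.
by rewrite (linear_add (vres_linear h)) !(endo_fun_res _ hV hW).
Defined.

Definition endo_scale (c : k) f : endo U.
Proof.
refine (@Endo U (fun V h s => c *: endo_fun f h s) _ _) => [V h a s t|V W hV hW h s].
  by rewrite endo_linear scalerDr !scalerA mulrC.
by rewrite (linear_scale (vres_linear h)) (endo_fun_res f hV hW).
Defined.

Fact endo_addA : associative endo_add.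
Proof. by move=> f g h; apply: endo_eq => *; apply: addrA. Qed.
Fact endo_addC : commutative endo_add.
Proof. by move=> f g; apply: endo_eq => *; apply: addrC. Qed.
Fact endo_add0 : left_id endo_zero endo_add.
Proof. by move=> f; apply: endo_eq => *; apply: add0r. Qed.
Fact endo_addN : left_inverse endo_zero endo_opp endo_add.
Proof. by move=> f; apply: endo_eq => *; apply: addNr. Qed.
HB.instance Definition _ :=
  GRing.isZmodule.Build (endo U) endo_addA endo_addC endo_add0 endo_addN.

Fact endo_scaleA (a b : k) f : endo_scale a (endo_scale b f) = endo_scale (a * b) f.
Proof. by apply: endo_eq => *; apply: scalerA. Qed.
Fact endo_scale1 : left_id 1 endo_scale.
Proof. by move=> f; apply: endo_eq => *; apply: scale1r. Qed.
Fact endo_scaleDr : right_distributive endo_scale +%R.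
Proof. by move=> c f g; apply: endo_eq => *; apply: scalerDr. Qed.
Fact endo_scaleDl f : {morph endo_scale^~ f : a b / a + b}.
Proof. by move=> a b; apply: endo_eq => *; apply: scalerDl. Qed.
HB.instance Definition _ :=
  GRing.Zmodule_isLmodule.Build k (endo U) endo_scaleA endo_scale1 endo_scaleDr endo_scaleDl.

Definition endo_id : endo U.
Proof. exact: (@Endo U (fun V h s => s)). Defined.

Definition endo_comp f g : endo U.
Proof.
refine (@Endo U (fun V h s => endo_fun g h (endo_fun f h s)) _ _) => [V h a s t|V W hV hW h s].
  by rewrite !endo_linear.
by rewrite !(endo_fun_res _ hV hW).
Defined.

(* Multiplication is composition in the opposite order, so that modules over *)
(* this algebra are right modules.                                           *)
Definition endo_alg : pzAlgType k.
Proof.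
refine (@PzAlg k (endo U) endo_id endo_comp _ _ _ _ _ _ _) => //.
- by move=> f g h; apply: endo_eq => *.
- by move=> f; apply: endo_eq => *.
- by move=> f; apply: endo_eq => *.
- by move=> f g h; apply: endo_eq => V i s; apply: linear_add; apply: endo_linear.
- by move=> f g h; apply: endo_eq => *.
- by move=> c f g; apply: endo_eq => V i s; apply/esym/linear_scale; apply: endo_linear.
- by move=> c f g; apply: endo_eq => *.
Defined.

End Module.

Definition endo_res (U V : opens X) (h : V `<=` U) (f : endo_alg U) : endo_alg V :=
  @Endo V (fun W hW s => endo_fun f (subset_trans hW h) s)
    (fun W hW => @endo_linear U f W (subset_trans hW h))
    (fun W W' hW hW' => @endo_fun_res U f W W' (subset_trans hW h) (subset_trans hW' h)).

Lemma endo_res_morphism (U V : opens X) (h : V `<=` U) : is_alg_morphism (endo_res h).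
Proof. by split=> [c f g|f g|]; apply: endo_eq. Qed.

Definition openIs (U V : opens X) : opens X := Opens (openI (oset_open U) (oset_open V)).

Lemma openIsl (U V : opens X) : openIs U V `<=` U.
Proof. by move=> x []. Qed.
Lemma openIsr (U V : opens X) : openIs U V `<=` V.
Proof. by move=> x []. Qed.

Lemma endo_is_sheaf : is_sheaf endo_res.
Proof.
have [Eid Ecomp Esep Eglue] := vres_sheaf E.
split=> [U h f|U V W h h' h'' f|U I V VU cov f g fg|U I V VU cov f agree].
- by apply: endo_eq => V hV s /=; congr endo_fun; apply: Prop_irrelevance.
- by apply: endo_eq => V' hV s /=; congr endo_fun; apply: Prop_irrelevance.
- apply: endo_eq => W h s.
  apply: (Esep W I (fun i => openIs (V i) W) (fun i => @openIsr (V i) W)).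
    by move=> x Wx; have [i _ Vx] := cov x (h x Wx); exists i.
  move=> i; have hi := subset_trans (@openIsl (V i) W) (VU i).
  rewrite !(endo_fun_res _ h hi).
  have := congr1 (fun e => endo_fun e (@openIsl (V i) W) (vres E (@openIsr (V i) W) s)) (fg i).
  by rewrite /= (Prop_irrelevance (subset_trans _ _) hi).
- have covW (W : opens X) (h : W `<=` U) : W `<=` \bigcup_i openIs (V i) W.
    by move=> x Wx; have [i _ Vx] := cov x (h x Wx); exists i.
  have glued (W : opens X) (h : W `<=` U) (s : E W) : exists t : E W, forall i,
      vres E (@openIsr (V i) W) t = endo_fun (f i) (@openIsl (V i) W) (vres E (@openIsr (V i) W) s).
    apply: (Eglue W I _ (fun i => @openIsr (V i) W) (covW W h)) => i j W' hi hj.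
    have hi' := subset_trans hi (@openIsl (V i) W).
    have hj' := subset_trans hj (@openIsl (V j) W).
    have hW := subset_trans hi (@openIsr (V i) W).
    rewrite (endo_fun_res _ _ hi') (endo_fun_res _ _ hj') !(Ecomp _ _ _ _ _ hW).
    have := congr1 (fun e => endo_fun e (@subset_refl _ W') (vres E hW s)) (agree i j W' hi' hj').
    by rewrite /= (Prop_irrelevance (subset_trans _ _) hi') (Prop_irrelevance (subset_trans _ _) hj').
  pose t (W : opens X) (h : W `<=` U) (s : E W) := sval (cid (glued W h s)).
  (* This describes the glued value on every open set inside both [W] and some [V i]; linearity and
     compatibility with restriction then follow by separatedness. *)
  have tE (W : opens X) (h : W `<=` U) (s : E W) (W' : opens X) i (hi : W' `<=` V i) (hW : W' `<=` W) :
      vres E hW (t W h s) = endo_fun (f i) hi (vres E hW s).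
    have hW' : W' `<=` openIs (V i) W by move=> x W'x; split; [apply: hi|apply: hW].
    rewrite -(Ecomp _ _ _ (@openIsr (V i) W) hW') /t; case: cid => /= u ->.
    by rewrite (endo_fun_res _ _ hi) (Ecomp _ _ _ _ _ hW).
  have t_lin (W : opens X) (h : W `<=` U) : linear (t W h).
    move=> c x y; apply: (Esep W I _ (fun i => @openIsr (V i) W) (covW W h)) => i.
    rewrite (vres_linear (@openIsr (V i) W)) !(tE _ _ _ _ _ (@openIsl (V i) W)).
    by rewrite (vres_linear (@openIsr (V i) W)) endo_linear.
  have t_res (W W' : opens X) (hW : W `<=` U) (hW' : W' `<=` U) (h : W' `<=` W) (s : E W) :
      vres E h (t W hW s) = t W' hW' (vres E h s).
    apply: (Esep W' I _ (fun i => @openIsr (V i) W') (covW W' hW')) => i.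
    have h' := subset_trans (@openIsr (V i) W') h.
    rewrite !(Ecomp _ _ _ _ _ h') !(tE _ _ _ _ _ (@openIsl (V i) W')).
    by rewrite (Ecomp _ _ _ _ _ h').
  exists (@Endo U t t_lin t_res) => i; apply: endo_eq => W h s /=.
  have := tE W (subset_trans h (VU i)) s W i h (@subset_refl _ W).
  by rewrite !Eid.
Qed.

Definition endo_sheaf : algSheaf k X :=
  @AlgSheaf k X endo_alg endo_res endo_res_morphism endo_is_sheaf.

End Endomorphisms.

(** * Calabi-Yau structures *)

Section FlatConnections.
Variables (k : fieldType) (X : topologicalType) (O : comAlgSheaf k X).
Variables (T : tangentSheaf O) (DX : diffOps T) (A : dAlgebra DX).
Variables (TA : tangentOver A) (DA : diffOpsOver A).

(* Here nabla (a (x) t) is to be read as the right action a . t. *)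
Record is_flat_right (nabla : forall U, TA U -> A U) : Prop := {
  flat_hom : @is_sheaf_hom k X TA A nabla;
  flat_mul : forall U (a b : A U) (t : T U),
    nabla U (tens TA (a * b) t) = nabla U (tens TA a t) * b - a * vf_act t b;
  flat_comm : forall U (a : A U) (s t : T U),
    nabla U (tens TA (nabla U (tens TA a s)) t) - nabla U (tens TA (nabla U (tens TA a t)) s)
    = nabla U (tens TA a (tan_br s t))
}.

Lemma alg_scale_mull U (c : k) (a b : A U) : c *: (a * b) = (c *: a) * b.
Proof. exact: alg_scaleAl. Qed.

Lemma alg_scale_mulr U (c : k) (a b : A U) : c *: (a * b) = a * (c *: b).
Proof. exact: alg_scaleAr. Qed.

Lemma vf_act_res (U V : opens X) (h : V `<=` U) (t : T U) (a : A U) :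
  ares A h (vf_act t a) = vf_act (vres T h t) (ares A h a).
Proof.
rewrite /vf_act (sheaf_hom_res (diff_vf_hom (diff_generated DX))).
exact/esym/(sheaf_bilinear_res (msc_bilinear (dmod A))).
Qed.

Section FromCY.
Variables (r : forall U, A U -> DA U -> A U) (CY : is_CY r).
Arguments r : clear implicits.

Let rr := cy_bilinear CY.

(** Apply to [a] the relation b t = t b - t(b) in [DA], where [b] acts by multiplication. *)
Lemma cy_mul_vf U (a b : A U) (t : T U) :
  r U (a * b) (diff_vf DA t) = r U a (diff_vf DA t) * b - a * vf_act t b.
Proof.
have [_ _ rM rA] := CY.
rewrite -!rA -!rM -(bilNr rr) -(bilDr rr); congr (r U a _).
by rewrite -(diff_commA (diff_generated DA)); zmod.
Qed.

Lemma cy_balanced : @is_balanced k X O T DX A A (fun U a t => r U a (diff_vf DA t)).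
Proof.
split=> [|U a f t]; first exact: bilinear_homr rr (diff_vf_hom (diff_generated DA)).
by rewrite (diff_vfZ (diff_generated DA)) (cy_mul CY) (cy_alg CY).
Qed.

Lemma flat_of_CY (nabla : forall U, TA U -> A U) :
  @is_sheaf_hom k X TA A nabla ->
  (forall U (a : A U) (t : T U), nabla U (tens TA a t) = r U a (diff_vf DA t)) ->
  is_flat_right nabla.
Proof.
move=> hn nE; split=> // [U a b t|U a s t]; first by rewrite !nE cy_mul_vf.
rewrite !nE -!(cy_mul CY) -(bilNr rr) -(bilDr rr).
by rewrite (diff_commT (diff_generated DA)).
Qed.

End FromCY.

Lemma exists_nabla_of_CY (c : CYStructure DA) :
  exists! nabla : forall U, TA U -> A U, nabla_of_CY c nabla.
Proof.
have [nabla [nablaP _]] := tens_universal TA (cy_balanced (svalP c)).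
exists nabla; split=> // nabla' [hn' nE'].
apply: (tangentOver_hom_eq nablaP.1 hn') => U a t.
by rewrite nablaP.2 nE'.
Qed.

Section ToCY.
Variables (nabla : forall U, TA U -> A U) (flat : is_flat_right nabla).
Arguments nabla : clear implicits.

Definition right_mul U (b : A U) : endo A U.
Proof.
refine (@Endo _ _ A U (fun V h s => (s : A V) * ares A h b) _ _) => [V h c s t|V W hV hW h s].
  by rewrite mulrDl -alg_scale_mull.
by rewrite /= (alg_morphismM (ares_morphism A h)) (res_comp (ares_sheaf A) _ _ hW).
Defined.

Definition right_vf U (t : T U) : endo A U.
Proof.
refine (@Endo _ _ A U (fun V h s => nabla V (tens TA s (vres T h t))) _ _)
  => [V h c x y|V W hV hW h s].
  by rewrite (bil_linl (tens_balanced TA).1) (hom_lin (flat_hom flat)).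
rewrite -(sheaf_hom_res (flat_hom flat)) -(sheaf_bilinear_res (tens_balanced TA).1).
by rewrite (res_comp (vres_sheaf T) _ _ hW).
Defined.

(** In the opposite endomorphism algebra, [diff_commA] is the Leibniz rule [flat_mul], [diff_commT]
    is [flat_comm], and [diff_vfZ] is the balancedness of [tens]. *)
Lemma right_generated :
  @is_diff_generated k X O T A (@dunit _ _ _ _ _ A) (@vf_act _ _ _ _ _ A) (endo_sheaf A)
    right_mul right_vf.
Proof.
have tens_bil := (tens_balanced TA).1.
split.
- split=> [U|U V h b]; last first.
    apply: endo_eq => W hW s; congr (_ * _).
    exact: (res_comp (ares_sheaf A)).
  split=> [c a b|a b|]; apply: endo_eq => V h s.
  + have := alg_morphism_linear (ares_morphism A h) c a b => /= ->.
    by rewrite mulrDr -alg_scale_mulr.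
  + by rewrite /= (alg_morphismM (ares_morphism A h)) mulrA.
  + by rewrite /= (alg_morphism1 (ares_morphism A h)) mulr1.
- split=> [U c s t|U V h t]; apply: endo_eq => W hW x /=.
    by rewrite (vres_linear hW) (bil_linr tens_bil) (hom_lin (flat_hom flat)).
  by rewrite (res_comp (vres_sheaf T) _ _ (subset_trans hW h)).
- move=> U f t; apply: endo_eq => V h s /=.
  rewrite -(sheaf_bilinear_res (msc_bilinear (tan_mod T))).
  by rewrite -(tens_balanced TA).2 (alg_hom_res (dunit_hom A)).
- move=> U t a; apply: endo_eq => V h s /=.
  by rewrite (flat_mul flat) vf_act_res; zmod.
- move=> U s t; apply: endo_eq => V h a /=.
  by rewrite -(sheaf_bilinear_res (tan_br_bilinear T)) -(flat_comm flat).
Qed.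

Lemma exists_CY_of_flat :
  exists! c : CYStructure DA, nabla_of_CY c nabla.
Proof.
have [phi [[phi_hom phiA phiT] phi_uniq]] := diff_universal DA right_generated.
pose r U (a : A U) (P : DA U) : A U := endo_fun (phi U P) (@subset_refl _ U) a.
have phi_lin U := alg_morphism_linear (alg_hom_morphism phi_hom U).
have CY : is_CY r.
  split.
  - split=> [U|U V h a P].
      split=> [P c a b|a c P Q]; first exact: endo_linear.
      by rewrite /r phi_lin.
    by rewrite /r (alg_hom_res phi_hom) /= -[RHS]/(vres A h _) (endo_fun_res _ _ (subset_trans (@subset_refl _ V) h) h).
  - by move=> U a; rewrite /r (alg_morphism1 (alg_hom_morphism phi_hom U)).
  - by move=> U a P Q; rewrite /r (alg_morphismM (alg_hom_morphism phi_hom U)).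
  - by move=> U a b; rewrite /r phiA /= (res_id (ares_sheaf A)).
have rE : nabla_of_CY (exist _ r CY) nabla.
  split=> [|U a t]; first exact: flat_hom.
  by rewrite /= /r phiT /= (res_id (vres_sheaf T)).
exists (exist _ r CY); split=> // -[r' CY'] [_ /= r'E]; apply: eq_exist => /=.
have rr' := cy_bilinear CY'.
have psi_lin U (P : DA U) (V : opens X) (h : V `<=` U) :
    linear (fun s : A V => r' V s (ares DA h P)).
  exact: ((sheaf_bilinearP rr' V).1 (ares DA h P)).
have psi_res U (P : DA U) (V W : opens X) (hV : V `<=` U) (hW : W `<=` U) (h : W `<=` V) (s : A V) :
    vres A h (r' V s (ares DA hV P)) = r' W (vres A h s) (ares DA hW P).
  by rewrite -(sheaf_bilinear_res rr') /= (res_comp (ares_sheaf DA) _ _ hW).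
(* Any other structure [r'] with the same [nabla] is also an algebra map to the endomorphisms,
   acting through restrictions of [P], and it agrees with [phi] on generators. *)
pose psi U (P : DA U) : endo_sheaf A U :=
  @Endo _ _ A U (fun V h s => r' V s (ares DA h P)) (psi_lin U P) (psi_res U P).
have phi_psi : phi = psi.
  apply: phi_uniq; split.
  - split=> [U|U V h P]; last first.
      apply: endo_eq => W hW s /=; congr (r' _ _ _).
      exact: (res_comp (ares_sheaf DA)).
    split=> [c P Q|P Q|]; apply: endo_eq => V h s /=.
    + by rewrite (alg_morphism_linear (ares_morphism DA h)) (bil_linr rr').
    + by rewrite (alg_morphismM (ares_morphism DA h)) (cy_mul CY').
    + by rewrite (alg_morphism1 (ares_morphism DA h)) (cy_one CY').
  - move=> U a; apply: endo_eq => V h s /=.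
    by rewrite -(alg_hom_res (diff_alg_hom (diff_generated DA))) (cy_alg CY').
  - move=> U t; apply: endo_eq => V h s /=.
    by rewrite r'E (sheaf_hom_res (diff_vf_hom (diff_generated DA))).
do 2! [apply: functional_extensionality_dep => ?]; apply: funext => P.
by rewrite /r phi_psi /= (res_id (ares_sheaf DA)).
Qed.

End ToCY.

End FlatConnections.

(** * The twisted product on pairs *)

Section ProductSheaf.
Variables (k : fieldType) (X : topologicalType) (F G : vecSheaf k X).

Definition prod_res (U V : opens X) (h : V `<=` U) (x : F U * G U) : F V * G V :=
  (vres F h x.1, vres G h x.2).

Lemma prod_res_linear (U V : opens X) (h : V `<=` U) : linear (prod_res h).
Proof. by move=> c x y; rewrite /prod_res /= !vres_linear. Qed.

Lemma prod_is_sheaf : is_sheaf prod_res.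
Proof.
have [Fid Fcomp Fsep Fglue] := vres_sheaf F; have [Gid Gcomp Gsep Gglue] := vres_sheaf G.
split=> [U h [x y]|U V W h h' h'' [x y]|U I V VU cov [x y] [x' y'] xy|U I V VU cov s agree].
- by rewrite /prod_res /= Fid Gid.
- by rewrite /prod_res /= (Fcomp _ _ _ _ _ h'') (Gcomp _ _ _ _ _ h'').
- congr (_, _).
    by apply: (Fsep U I V VU cov) => i; have [] := xy i.
  by apply: (Gsep U I V VU cov) => i; have [] := xy i.
- have [|x xE] := Fglue U I V VU cov (fun i => (s i).1).
    by move=> i j W hi hj; have [] := agree i j W hi hj.
  have [|y yE] := Gglue U I V VU cov (fun i => (s i).2).
    by move=> i j W hi hj; have [] := agree i j W hi hj.
  by exists (x, y) => i; rewrite /prod_res /= xE yE -surjective_pairing.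
Qed.

Definition prod_sheaf : vecSheaf k X :=
  @VecSheaf k X (fun U => (F U * G U)%type) prod_res prod_res_linear prod_is_sheaf.

End ProductSheaf.

Section Gerstenhaber.
Variables (k : fieldType) (X : topologicalType) (G : gradedAlg k X) (S : gerstenhaber G).

Lemma gbr_mul_left (i j l ij jl il n : int)
    (e1 : i + j = ij) (e2 : ij + l + 1 = n) (e3 : j + l + 1 = jl) (e4 : i + jl = n)
    (e5 : i + l + 1 = il) (e6 : il + j = n) U (a : G i U) (b : G j U) (c : G l U) :
  gbr S e2 (gmul e1 a b) c =
  gmul e4 a (gbr S e3 b c) + sign k (j * (l - 1)) *: gmul e6 (gbr S e5 a c) b.
Proof.
have f2 : l + ij + 1 = n by lia.
have f3 : l + j + 1 = jl by lia.
have f5 : l + i + 1 = il by lia.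
have f6 : jl + i = n by lia.
have f7 : j + il = n by lia.
rewrite (gbr_antisym S e2 f2) (gbr_mul S e1 f2 f5 e6 f3 e4).
rewrite (gbr_antisym S f5 e5) (gbr_antisym S f3 e3).
rewrite !(bilNl (gmul_bilinear G _), bilNr (gmul_bilinear G _), bilZl (gmul_bilinear G _), bilZr (gmul_bilinear G _)).
rewrite !(scalerDr, scalerN, scalerA) opprD !opprK addrC.
by subst ij; sign_zmod i j l.
Qed.

Lemma gbr_one_right (i n : int) (e : i + 0 + 1 = n) U (a : G i U) :
  gbr S e a (gone G U) = 0.
Proof.
have e4 : n + 0 = n by lia.
have e6 : 0 + n = n by lia.
have := gbr_mul S (addr0 0) e e e4 e e6 a (gone G U) (gone G U).
rewrite gmul1r gmul1r gmul1l mulr0 signE /= expr0 scale1r => /eqP.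
by rewrite -subr_eq0 opprD addNKr oppr_eq0 => /eqP.
Qed.

Lemma gbr_one_left (i n : int) (e : 0 + i + 1 = n) U (a : G i U) :
  gbr S e (gone G U) a = 0.
Proof.
have e' : i + 0 + 1 = n by lia.
by rewrite (gbr_antisym S e e') gbr_one_right scaler0 oppr0.
Qed.

(** Fixed proofs of the degree equations make equal products into equal terms, which [zmod] needs in
    order to treat them as one atom. *)
Lemma succ_left (i j n : int) : i + j = n -> i + 1 + j = n + 1.
Proof. by lia. Qed.
Lemma succ_right (i j n : int) : i + j = n -> i + (j + 1) = n + 1.
Proof. by lia. Qed.
Lemma succ_out (i j n : int) : i + j = n -> i + j + 1 = n + 1.
Proof. by lia. Qed.

(** Read (x, y) as x + h y with h of degree -1 and square 0: this is the product of the extended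
    algebra, with a bracket term added, and [sign k i] comes from moving h past [a.1]. *)
Definition bv_mul (i j n : int) (e : i + j = n) U
    (a : prod_sheaf (G i) (G (i + 1)) U) (b : prod_sheaf (G j) (G (j + 1)) U) :
    prod_sheaf (G n) (G (n + 1)) U :=
  (gmul e a.1 b.1,
   gmul (succ_left e) a.2 b.1
   + (sign k i *: gmul (succ_right e) a.1 b.2 + sign k i *: gbr S (succ_out e) a.1 b.1)).

Lemma bv_mul_bilinear (i j n : int) (e : i + j = n) : is_sheaf_bilinear (@bv_mul i j n e).
Proof.
have mb i' j' n' (e' : i' + j' = n') := gmul_bilinear G e'.
have bb := gbr_bilinear S (succ_out e).
split=> [U|U V h a b]; last first.
  rewrite /bv_mul /= !(sheaf_bilinear_res (mb _ _ _ _)) (sheaf_bilinear_res bb).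
  congr (_, _); have rl := vres_linear (v := G (n + 1)) h.
  by rewrite !(linear_add rl) !(linear_scale rl).
split=> [b|a] c x y; congr (_, _) => /=;
  rewrite ?(bilDl (mb _ _ _ _), bilDr (mb _ _ _ _), bilDl bb, bilDr bb);
  rewrite ?(bilZl (mb _ _ _ _), bilZr (mb _ _ _ _), bilZl bb, bilZr bb) //;
  rewrite !scalerDr !scalerA ![_ * c]mulrC; zmod.
Qed.

(* The pairs (x, y) with y in degree |x| + 1, multiplied so that x |-> (x, d x) *)
(* is multiplicative exactly when d satisfies the BV identity; associativity    *)
(* says that (-1)^|a| [a,b] is a Hochschild cocycle.                            *)
Definition bv_graded : gradedAlg k X.
Proof.
refine (@GradedAlg k X (fun i => prod_sheaf (G i) (G (i + 1))) bv_mul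
  (fun U => (gone G U, 0)) bv_mul_bilinear _ _ _ _).
- by move=> U V h; rewrite /= /prod_res /= gone_res (linear_zero (vres_linear h)).
- move=> i e U [a a']; rewrite /bv_mul /= (bil0l (gmul_bilinear G _)) gbr_one_left.
  by rewrite !gmul1l signE expr0 scale1r scaler0 add0r addr0.
- move=> i e U [a a']; rewrite /bv_mul /= (bil0r (gmul_bilinear G _)) gbr_one_right.
  by rewrite !gmul1r !scaler0 !addr0.
- move=> i j l ij jl n e1 e2 e3 e4 U [a a'] [b b'] [c c']; rewrite /bv_mul /=.
  congr (_, _); first exact: gmulA.
  rewrite !(bilDl (gmul_bilinear G _), bilDr (gmul_bilinear G _)).
  rewrite !(bilZl (gmul_bilinear G _), bilZr (gmul_bilinear G _)).
  have e5 : i + l + 1 = i + l + 1 by [].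
  have e6 : j + (i + l + 1) = n + 1 by lia.
  have e7 : i + l + 1 + j = n + 1 by lia.
  rewrite (gbr_mul S e1 (succ_out e2) (succ_out e3) (succ_left e4) e5 e6).
  rewrite (gbr_mul_left e3 (succ_out e4) (succ_out e1) (succ_right e2) e5 e7).
  (* One bracketing yields b[a,c] and the other [a,c]b; commutativity matches these two terms. *)
  rewrite (gmulC S e6 e7).
  rewrite (gmulA e1 (succ_left e2) (succ_left e3) (succ_left e4)).
  rewrite (gmulA (succ_left e1) (succ_right e2) (succ_right e3) (succ_left e4)).
  rewrite (gmulA (succ_right e1) (succ_right e2) e3 (succ_right e4)).
  rewrite !(scalerDr, scalerN, scalerA).
  by subst ij jl; sign_zmod i j l.
Defined.

End Gerstenhaber.

(** * The curvature of a BV operator *)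

Section BVOperators.
Variables (k : fieldType) (X : topologicalType) (G : gradedAlg k X) (S : gerstenhaber G).

(** A BV differential before d^2 = 0 is imposed, with its identity solved for d(ab). *)
Record is_bv_operator (d : forall i U, G i U -> G (i + 1) U) : Prop := {
  bvop_hom : forall i, is_sheaf_hom (d i);
  bvop_mul : forall (i j n : int) (e : i + j = n) U (a : G i U) (b : G j U),
    d n U (gmul e a b) =
    gmul (succ_left e) (d i U a) b
    + (sign k i *: gmul (succ_right e) a (d j U b) + sign k i *: gbr S (succ_out e) a b)
}.

Section Curvature.
Variables (d : forall i U, G i U -> G (i + 1) U) (bvd : is_bv_operator d).
Arguments d : clear implicits.

(* The failure of d to be a derivation of the bracket. *)
Definition bv_curv (i j n : int) (e : i + j = n) U (a : G i U) (b : G j U) : G (n + 1 + 1) U :=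
  d (n + 1) U (gbr S (succ_out e) a b) - gbr S (succ_out (succ_left e)) (d i U a) b
  - sign k (i - 1) *: gbr S (succ_out (succ_right e)) a (d j U b).

Lemma bv_curv_bilinear (i j n : int) (e : i + j = n) : is_sheaf_bilinear (@bv_curv i j n e).
Proof.
have bb i' j' n' (f : i' + j' + 1 = n') := gbr_bilinear S f.
apply: bilinear_sub; last apply: bilinear_scale.
  apply: bilinear_sub; first exact: bilinear_hom (bb _ _ _ _) (bvop_hom bvd (n + 1)).
  exact: bilinear_homl (bb _ _ _ _) (bvop_hom bvd i).
exact: bilinear_homr (bb _ _ _ _) (bvop_hom bvd j).
Qed.

Definition bvE := (fun i => hom_addE (bvop_hom bvd i), fun i => hom_scaleE (bvop_hom bvd i)).

(** In the expansion of d(d(ab)) the two products of da and db cancel, and the terms d[a,b], [da,b],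
    [a,db] add up to the curvature. *)
Lemma bv_square_mul (i j n : int) (e : i + j = n) U (a : G i U) (b : G j U) :
  d _ U (d n U (gmul e a b)) =
  gmul (succ_left (succ_left e)) (d _ U (d i U a)) b
  + gmul (succ_right (succ_right e)) a (d _ U (d j U b)) + sign k i *: bv_curv e a b.
Proof.
rewrite (bvop_mul bvd) !bvE !(bvop_mul bvd) /bv_curv.
rewrite (eq_irrelevance (succ_right (succ_left e)) (succ_left (succ_right e))).
rewrite !(scalerDr, scalerN, scalerA).
by sign_zmod i j n.
Qed.

(** Applying d to [a,b]c, b[a,c] and bc creates the double brackets [[a,b],c], [b,[a,c]] and
    [a,[b,c]], which cancel by the Jacobi identity. *)
Lemma bv_curv_mul (i j l ij jl il n : int)
    (e1 : j + l = jl) (e2 : i + jl = n) (e3 : i + j = ij)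
    (e4 : ij + l = n) (e5 : i + l = il) (e6 : j + il = n)
    U (a : G i U) (b : G j U) (c : G l U) :
  bv_curv e2 a (gmul e1 b c) =
  gmul (succ_left (succ_left e4)) (bv_curv e3 a b) c
  + sign k (i * j) *: gmul (succ_right (succ_right e6)) b (bv_curv e5 a c).
Proof.
have mb i' j' n' (f : i' + j' = n') := gmul_bilinear G f.
have bb i' j' n' (f : i' + j' + 1 = n') := gbr_bilinear S f.
rewrite /bv_curv.
rewrite (gbr_mul S e1 (succ_out e2) (succ_out e3) (succ_left e4) (succ_out e5) (succ_right e6)).
rewrite (gbr_mul S e1 (succ_out (succ_left e2)) (succ_out (succ_left e3))
  (succ_left (succ_left e4)) (succ_out (succ_left e5)) (succ_right (succ_right e6))).
rewrite !bvE !(bvop_mul bvd).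
rewrite !(bilDr (bb _ _ _ _), bilZr (bb _ _ _ _)).
rewrite (gbr_mul S (succ_left e1) (succ_out (succ_right e2)) (succ_out (succ_right e3))
  (succ_left (succ_left e4)) (succ_out e5) (succ_left (succ_right e6))).
rewrite (gbr_mul S (succ_right e1) (succ_out (succ_right e2)) (succ_out e3)
  (succ_right (succ_left e4)) (succ_out (succ_right e5)) (succ_right (succ_right e6))).
rewrite (gbr_jacobi S (succ_out e1) (succ_out (succ_right e2)) (succ_out e3)
  (succ_out (succ_left e4)) (succ_out e5) (succ_out (succ_right e6))).
rewrite !(bilDl (mb _ _ _ _), bilNl (mb _ _ _ _), bilZl (mb _ _ _ _)).
rewrite !(bilDr (mb _ _ _ _), bilNr (mb _ _ _ _), bilZr (mb _ _ _ _)).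
rewrite !(scalerDr, scalerN, scalerA).
by subst ij; sign_zmod i j l.
Qed.

(** By commutativity d^2(ab) and d^2(ba) agree up to sign, and so do the derivation parts of their
    expansions; hence so do the curvature terms. *)
Lemma bv_curv_sym (i j n : int) (e : i + j = n) (e' : j + i = n) U (a : G i U) (b : G j U) :
  bv_curv e a b = 0 -> bv_curv e' b a = 0.
Proof.
move=> ab0; have := bv_square_mul e' b a; rewrite (gmulC S e' e) !bvE.
rewrite bv_square_mul ab0 scaler0 addr0.
rewrite (gmulC S (succ_left (succ_left e')) (succ_right (succ_right e))).
rewrite (gmulC S (succ_right (succ_right e')) (succ_left (succ_left e))).
move: (gmul _ _ _) (gmul _ _ _) (bv_curv e' b a) => x y c /eqP.
rewrite eq_sym -subr_eq0 => /eqP /(congr1 (GRing.scale (sign k j))).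
rewrite scaler0 => <-; rewrite !(scalerDr, scalerN, scalerA).
by sign_zmod i j n.
Qed.

Lemma bv_curv_eq0 : (forall i U (x : G i U), d _ U (d i U x) = 0) ->
  forall (i j n : int) (e : i + j = n) U (a : G i U) (b : G j U), bv_curv e a b = 0.
Proof.
move=> d2 i j n e U a b; have := bv_square_mul e a b.
rewrite !d2 (bil0l (gmul_bilinear G _)) (bil0r (gmul_bilinear G _)) !add0r.
by move=> /(congr1 (GRing.scale (sign k i))); rewrite scaler0 scalerA signE -signr_addb addbb scale1r.
Qed.

End Curvature.
End BVOperators.

(** * Batalin-Vilkovisky structures *)

Section BVDifferential.
Variables (k : fieldType) (X : topologicalType) (G : gradedAlg k X) (S : gerstenhaber G).

Lemma bv_operator_of_BV (d : forall i n : int, i + 1 = n -> forall U, G i U -> G n U) :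
  is_BV S d -> is_bv_operator S (fun i => d i (i + 1) erefl).
Proof.
move=> BV; split=> [i|i j n e U a b]; first exact: (bv_hom BV erefl).
rewrite (bv_bracket BV (succ_out e) e erefl erefl (succ_left e) erefl (succ_right e)).
by zmod.
Qed.

Definition shift_diff (d : forall i U, G i U -> G (i + 1) U) (i n : int) (e : i + 1 = n) U
  (x : G i U) : G n U := eq_rect (i + 1) (fun n => G n U) (d i U x) n e.

Lemma shift_diff_BV (d : forall i U, G i U -> G (i + 1) U) :
  is_bv_operator S d -> (forall i U (x : G i U), d (i + 1) U (d i U x) = 0) ->
  is_BV S (shift_diff d).
Proof.
move=> [d_hom dM] d2; split.
- by move=> i n e; subst n; apply: d_hom.
- by move=> i j n e e' U a; subst j n; apply: d2.
- move=> i j i1 j1 ij n e e1 e2 e3 e4 e5 e6 U a b; subst i1 j1 ij n.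
  rewrite (eq_irrelevance e2 erefl) /= dM.
  rewrite (eq_irrelevance e4 (succ_left erefl)) (eq_irrelevance e6 (succ_right erefl)).
  rewrite (eq_irrelevance (succ_out _) erefl).
  by zmod.
Qed.

Lemma shift_diffK (d : forall i n : int, i + 1 = n -> forall U, G i U -> G n U) :
  shift_diff (fun i => d i (i + 1) erefl) = d.
Proof.
apply: functional_extensionality_dep => i; apply: functional_extensionality_dep => n.
by apply: functional_extensionality_dep => e; case: n / e.
Qed.

End BVDifferential.

Section ExteriorBV.
Variables (k : fieldType) (X : topologicalType) (O : comAlgSheaf k X).
Variables (T : tangentSheaf O) (DX : diffOps T) (A : dAlgebra DX).
Variables (TA : tangentOver A) (L : exteriorAlg (tanA_mod TA)) (S : schouten L).

Fact deg_vec_scal : -1 + 0 + 1 = 0 :> int. Proof. by []. Qed.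
Fact deg_vec_vec : -1 + -1 + 1 = -1 :> int. Proof. by []. Qed.

Lemma ext_scal_inj U : injective (@ext_scal _ _ _ _ _ L U).
Proof.
have [rho [_ rhoK _]] := exterior_scal_iso L.
exact: can_inj (@rhoK U).
Qed.

Lemma ext_scalD U (a b : A U) : ext_scal L (a + b) = ext_scal L a + ext_scal L b.
Proof. exact: (hom_addE (alt_alg_hom (ext_alternating L))). Qed.

Lemma ext_scalN U (a : A U) : ext_scal L (- a) = - ext_scal L a.
Proof. exact: (hom_oppE (alt_alg_hom (ext_alternating L))). Qed.

Lemma ext_scal0 U : ext_scal L (0 : A U) = 0.
Proof. exact: (hom_zero (alt_alg_hom (ext_alternating L))). Qed.

Lemma ext_scal_comm (i n : int) (e : 0 + i = n) (e' : i + 0 = n) U (a : A U) (x : L i U) :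
  gmul e (ext_scal L a) x = gmul e' x (ext_scal L a).
Proof.
have i_n : i = n by lia.
have [_ _ _ aC _ _ _] := ext_alternating L.
by move: e e'; rewrite -i_n => e e'; apply: aC.
Qed.

Lemma ext_pos_eq i U (x y : L i U) : 0 < i -> x = y.
Proof. by move=> i0; rewrite (exterior_pos x i0) (exterior_pos y i0). Qed.

Lemma gbr_vec_scal (e : -1 + 0 + 1 = 0 :> int) (e' : 0 + -1 + 1 = 0 :> int) U (x : TA U) (a : A U) :
  gbr S e' (ext_scal L a) (ext_vec L x) = - gbr S e (ext_vec L x) (ext_scal L a).
Proof. by rewrite (gbr_antisym S e' e) signE expr0 scale1r. Qed.

Lemma tens_msc U (a b : A U) (t : T U) :
  msc (tanA_mod TA) b (tens TA a t) = tens TA (a * b) t.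
Proof. by rewrite -tensZ calgC. Qed.

(** On [TA] the differential takes values in degree 0 of [L], which is [A] by
    [exterior_scal_iso]. *)
Lemma exists_nabla_of_BV (b : BVStructure S) :
  exists! nabla : forall U, TA U -> A U, nabla_of_BV b nabla.
Proof.
have [rho [rho_hom rhoK scalK]] := exterior_scal_iso L.
case: b => d BV.
have e : -1 + 1 = 0 :> int by [].
exists (fun U x => rho U (d (-1) 0 e U (ext_vec L x))); split.
  split=> [|e' U x]; last by rewrite scalK (eq_irrelevance e e').
  exact: (hom_comp (hom_comp (alt_mod_hom (ext_alternating L)) (bv_hom BV e)) rho_hom).
move=> nabla [_ nE]; apply: functional_extensionality_dep => U; apply: funext => x.
by have /= <- := nE e U x; rewrite rhoK.
Qed.

Section Curvature.
Variables (d : forall i U, L i U -> L (i + 1) U) (bvd : is_bv_operator S d).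
Variable nabla : forall U, TA U -> A U.
Arguments d : clear implicits.
Arguments nabla : clear implicits.
Hypothesis nabla_hom : @is_sheaf_hom k X TA A nabla.
Hypothesis d_vec : forall U (x : TA U), d (-1) U (ext_vec L x) = ext_scal L (nabla U x).

(** This is the BV identity for the product of the scalar [b] and the vector a t: d b vanishes for
    degree reasons, and the bracket of b with a t is -a t(b). *)
Lemma nabla_mul U (a b : A U) (t : T U) :
  nabla U (tens TA (a * b) t) = nabla U (tens TA a t) * b - a * vf_act t b.
Proof.
have [aA aM a1 aC aV aZ _] := ext_alternating L.
apply: ext_scal_inj; rewrite -d_vec -tens_msc (aZ (add0r (-1))).
rewrite (bvop_mul bvd) (exterior_pos (d 0 U _)) // (bil0l (gmul_bilinear L _)) add0r.
rewrite signE expr0 !scale1r d_vec.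
rewrite (gbr_vec_scal deg_vec_scal) sch_act.
rewrite ext_scalD ext_scalN [_ * b]calgC; congr (_ - _).
symmetry; refine (aM _ U b (nabla U (tens TA a t))).

Qed.

Lemma bv_curv_tens U (a b : A U) (s t : T U) :
  bv_curv S d (erefl (-1 + -1)) (ext_vec L (tens TA a s)) (ext_vec L (tens TA b t)) =
  ext_scal L (nabla U (tens TA (a * b) (tan_br s t))
    - (nabla U (tens TA (nabla U (tens TA (a * b) s)) t)
       - nabla U (tens TA (nabla U (tens TA (a * b) t)) s))).
Proof.
have [aA aM a1 aC aV aZ _] := ext_alternating L.
rewrite /bv_curv !d_vec signE expr0 scale1r.
rewrite (gbr_vec_scal deg_vec_scal).
rewrite (eq_irrelevance (succ_out (erefl (-1 + -1))) deg_vec_vec) sch_lie.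
rewrite d_vec !sch_act -!ext_scalN -!ext_scalD; congr (ext_scal L _).
(* The Leibniz rule solved for the derivative turns the brackets into values of [nabla]; the
   products of two such values then cancel. *)
have act_mul x y u : x * vf_act u y = nabla U (tens TA x u) * y - nabla U (tens TA (x * y) u).
  by rewrite nabla_mul; zmod.
rewrite !act_mul (calgC (nabla U (tens TA b t)) a) (calgC (nabla U (tens TA a s)) b) (calgC b a).
rewrite (calgC (nabla U (tens TA b t)) (nabla U (tens TA a s))).
have bt := (tens_balanced TA).1.
rewrite !(hom_addE nabla_hom, hom_oppE nabla_hom, bilDl bt, bilNl bt).
by zmod.
Qed.

End Curvature.

Lemma flat_of_BV (b : BVStructure S) (nabla : forall U, TA U -> A U) :
  nabla_of_BV b nabla -> is_flat_right nabla.
Proof.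
case: b => d BV [nabla_hom nE].
have bvd := bv_operator_of_BV BV.
have d_vec U (x : TA U) : d (-1) (-1 + 1) erefl U (ext_vec L x) = ext_scal L (nabla U x).
  by symmetry; apply: nE.
split=> // [U a b t|U a s t]; first exact: (nabla_mul bvd d_vec).
have d2 i U' (x : L i U') : d (i + 1) (i + 1 + 1) erefl U' (d i (i + 1) erefl U' x) = 0.
  exact: (bv_square BV erefl erefl).
(* The coefficient 1 for [t] turns the product [a * b] of [bv_curv_tens] into [a], so the vanishing
   curvature is flatness at [a]. *)
have := bv_curv_eq0 bvd d2 (erefl (-1 + -1)) (ext_vec L (tens TA a s)) (ext_vec L (tens TA 1 t)).
rewrite (bv_curv_tens bvd nabla_hom d_vec) mulr1 => scal0.
apply/esym/eqP; rewrite -subr_eq0; apply/eqP; apply: ext_scal_inj; rewrite scal0.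
exact/esym/ext_scal0.
Qed.

Section ToBV.
Hypothesis k_char0 : [pchar k] =i pred0.
Variables (nabla : forall U, TA U -> A U) (flat : is_flat_right nabla).
Arguments nabla : clear implicits.

(** In degree -1 the bracket is antisymmetric, so twice [x,x] is 0; here the characteristic of [k]
    enters. *)
Lemma gbr_vec_self (n : int) (e : -1 + -1 + 1 = n) U (x : TA U) :
  gbr S e (ext_vec L x) (ext_vec L x) = 0.
Proof.
have two_neq0 : 2%:R != 0 :> k.
  by apply/negP => two0; have := k_char0 2; rewrite !inE two0.
move: (gbr_antisym S e e (ext_vec L x) (ext_vec L x)); rewrite signE expr0 scale1r.
move=> /eqP; rewrite -subr_eq0 opprK -mulr2n -scaler_nat scaler_eq0 (negbTE two_neq0).
by move=> /eqP.
Qed.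

(** Both sides are bilinear, and on x = [tens TA b t] this is the Leibniz rule [flat_mul]. *)
Lemma scal_nabla_msc (e : 0 + 0 = 0 :> int) (e' : 0 + -1 + 1 = 0 :> int) U (x : TA U) (a : A U) :
  ext_scal L (nabla U (msc (tanA_mod TA) a x)) =
  gmul e (ext_scal L a) (ext_scal L (nabla U x)) + gbr S e' (ext_scal L a) (ext_vec L x).
Proof.
have [aA aM a1 aC aV aZ _] := ext_alternating L.
have nh := flat_hom flat.
have b1 : @is_sheaf_bilinear k X TA A (L 0)
    (fun U x a => ext_scal L (nabla U (msc (tanA_mod TA) a x))).
  exact: bilinear_flip (bilinear_hom (msc_bilinear (tanA_mod TA)) (hom_comp nh aA)).
have b2 : @is_sheaf_bilinear k X TA A (L 0) (fun U x a =>
    gmul e (ext_scal L a) (ext_scal L (nabla U x)) + gbr S e' (ext_scal L a) (ext_vec L x)).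
  apply: bilinear_add; apply: bilinear_flip.
    exact: bilinear_homl (bilinear_homr (gmul_bilinear L e) (hom_comp nh aA)) aA.
  exact: bilinear_homl (bilinear_homr (gbr_bilinear S e') aV) aA.
apply: (tangentOver_bilinear_eq b1 b2) => {x a}V a t b.
rewrite tens_msc (flat_mul flat) (gbr_vec_scal deg_vec_scal) sch_act.
by rewrite ext_scalD ext_scalN [_ * b]calgC (aM e).
Qed.

(** In second components, linearity over [A] is [scal_nabla_msc]; the square of a vector vanishes
    because [x,x] = 0 and the products of x and its [nabla] occur with opposite signs. A scalar is
    paired with 0, as [L] vanishes in degree 1. *)
Lemma nabla_alternating :
  @is_alternating _ _ _ _ (tanA_mod TA) (bv_graded S) (fun U a => (ext_scal L a, 0))
    (fun U x => (ext_vec L x, ext_scal L (nabla U x))).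
Proof.
have [aA aM a1 aC aV aZ asq] := ext_alternating L.
have nh := hom_comp (flat_hom flat) aA.
split.
- split=> [U c a b|U V h a]; congr (_, _); try exact: ext_pos_eq.
    exact: hom_lin aA _ _ _ _.
  exact: (sheaf_hom_res aA).
- by move=> e U a b; congr (_, _); [apply: aM|apply: ext_pos_eq].
- by move=> U; congr (_, _); apply: a1.
- move=> i e e' U a [x x']; congr (_, _); first exact: aC.
  rewrite /= (bil0l (gmul_bilinear L _)) (bil0r (gmul_bilinear L _)).
  rewrite (aC _ (succ_right e) (succ_left e')) (gbr_antisym S (succ_out e) (succ_out e')).
  rewrite !(scalerN, scalerA) scaler0 !add0r.
  by sign_zmod i i i.
- split=> [U c x y|U V h x]; congr (_, _).
  + exact: hom_lin aV _ _ _ _.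
  + exact: hom_lin nh _ _ _ _.
  + exact: (sheaf_hom_res aV).
  + exact: (sheaf_hom_res nh).
- move=> e U a x; congr (_, _); first exact: aZ.
  rewrite /= (bil0l (gmul_bilinear L _)) add0r signE expr0 !scale1r.
  exact: (scal_nabla_msc (succ_right e) (succ_out e)).
- move=> n e U x; subst n; congr (_, _); first exact: asq.
  rewrite /= gbr_vec_self scaler0 addr0.
  move: (succ_left _) (succ_right _) => e1 e2.
  rewrite (@ext_scal_comm (-1) (-1 + -1 + 1) e1 e2 U (nabla U x) (ext_vec L x)).
  by rewrite signE expr1 scaleN1r subrr.
Qed.

Section Square.
Variables (d : forall i U, L i U -> L (i + 1) U) (bvd : is_bv_operator S d).
Arguments d : clear implicits.
Hypothesis curv_tens : forall U (a b : A U) (s t : T U),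
  bv_curv S d (erefl (-1 + -1)) (ext_vec L (tens TA a s)) (ext_vec L (tens TA b t)) = 0.

Lemma bv_curv_vec U (x y : TA U) :
  bv_curv S d (erefl (-1 + -1)) (ext_vec L x) (ext_vec L y) = 0.
Proof.
have aV := alt_mod_hom (ext_alternating L).
have [bl br] := bilinear_homl (bilinear_homr (bv_curv_bilinear bvd (erefl (-1 + -1))) aV) aV.
apply: (tangentOver_family_zero (fun U => (bl U).1) br) => {U x y}U a s y.
(* The first argument is now a pure tensor; its two factors become the parameter while the second
   argument is reduced in turn. *)
apply: (tangentOver_family_zero (I := fun U => (A U * T U)%type)
  (ires := fun U V h z => (vres A h z.1, vres T h z.2))
  (b := fun U y z => bv_curv S d (erefl (-1 + -1)) (ext_vec L (tens TA z.1 z.2)) (ext_vec L y))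
  _ _ _ y (a, s)).
- by move=> V z; apply: (bl V).2.
- by move=> V W h x z; rewrite /= (sheaf_bilinear_res (tens_balanced TA).1) br.
- by move=> V b t z; apply: curv_tens.
Qed.

Section Induction.
Variables (F : vecSheaf k X) (i : int) (f : forall U, F U -> L i U) (hf : is_sheaf_hom f).
Arguments f : clear implicits.
Hypothesis f_scal : forall U (w : F U) (a : A U),
  bv_curv S d (erefl (i + 0)) (f U w) (ext_scal L a) = 0.
Hypothesis f_vec : forall U (w : F U) (x : TA U),
  bv_curv S d (erefl (i + -1)) (f U w) (ext_vec L x) = 0.

(** The curvature is a derivation in [y], so generators suffice there. The first argument runs over
    the image of a sheaf map [f], which will be the inclusion of the scalars, that of the vectors,
    and the identity. *)
Lemma bv_curv_ind j U (w : F U) (y : L j U) : bv_curv S d (erefl (i + j)) (f U w) y = 0.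
Proof.
pose b j := bilinear_flip (bilinear_homl (bv_curv_bilinear bvd (erefl (i + j))) hf).
move: w; apply: (annihilatorP (b_linear := fun U => (sheaf_bilinearP (b j) U).1)
  (b_res := sheaf_bilinear_res (b j))).
move: j U y; apply: exterior_ind => [U a V h w|U x V h w|j l n e U x y x0 y0 V h w].
- by rewrite -(sheaf_hom_res (alt_alg_hom (ext_alternating L))) f_scal.
- by rewrite -(sheaf_hom_res (alt_mod_hom (ext_alternating L))) f_vec.
- subst n; rewrite -(sheaf_bilinear_res (gmul_bilinear L _)).
  rewrite (bv_curv_mul bvd _ _ erefl (esym (addrA i j l)) erefl (addrCA j i l)).
  rewrite (x0 V h w) (y0 V h w).
  by rewrite (bil0l (gmul_bilinear L _)) (bil0r (gmul_bilinear L _)) scaler0 addr0.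
Qed.

End Induction.

(** The curvature raises the total degree by 2, so on a scalar and a generator it lands in degree 1
    or 2, where [L] vanishes. *)
Lemma bv_curv_scal_left j n (e : 0 + j = n) U (a : A U) (y : L j U) :
  bv_curv S d e (ext_scal L a) y = 0.
Proof.
subst n; apply: (bv_curv_ind (alt_alg_hom (ext_alternating L))) => {U a y}U a y.
  by apply: exterior_pos.
by apply: exterior_pos.
Qed.

Lemma bv_curv_vec_left j n (e : -1 + j = n) U (x : TA U) (y : L j U) :
  bv_curv S d e (ext_vec L x) y = 0.
Proof.
subst n; apply: (bv_curv_ind (alt_mod_hom (ext_alternating L))) => {U x y}U x y.
  by apply: exterior_pos.
exact: bv_curv_vec.
Qed.

(** With a generator as second argument, [bv_curv_sym] exchanges the arguments and reduces to a
    generator on the left. *)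
Lemma bv_curv_vanish i j n (e : i + j = n) U (x : L i U) (y : L j U) : bv_curv S d e x y = 0.
Proof.
subst n; apply: (bv_curv_ind (hom_id (L i))) => {U x y}U x y.
  exact: (bv_curv_sym bvd _ (bv_curv_scal_left (addrC 0 i) y x)).
exact: (bv_curv_sym bvd _ (bv_curv_vec_left (addrC (-1) i) y x)).
Qed.

(** Without curvature d^2 is a derivation, and it sends the generators to degrees 2 and 1, where [L]
    is zero. *)
Lemma bv_square_zero i U (x : L i U) : d (i + 1) U (d i U x) = 0.
Proof.
have d_hom i' := bvop_hom bvd i'.
suff /(_ i U x tt) : forall i U (x : L i U),
  kernel (fun _ : unit => hom_comp (d_hom i) (d_hom (i + 1))) U x by [].
apply: exterior_ind => {i U x}[U a _|U x _|i j n e U x y /(_ tt) x0 /(_ tt) y0 _].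
- by apply: exterior_pos.
- by apply: exterior_pos.
- rewrite (bv_square_mul bvd) bv_curv_vanish x0 y0.
  by rewrite (bil0l (gmul_bilinear L _)) (bil0r (gmul_bilinear L _)) scaler0 !addr0.
Qed.

End Square.

Lemma exists_BV_of_flat : exists! b : BVStructure S, nabla_of_BV b nabla.
Proof.
have altL := ext_alternating L.
have [phi [[phi_hom phiA phiV] phi_uniq]] := ext_universal L nabla_alternating.
have [psi [_ psi_uniq]] := ext_universal L altL.
(* The first component of [phi] is a graded endomorphism of [L] that fixes the generators, hence the
   identity; d is the second component. *)
have fst_phi : (fun i U x => (phi i U x).1) = (fun i U (x : L i U) => x).
  have <- : psi = fun i U x => x by apply: psi_uniq; split.
  symmetry; apply: psi_uniq; have [hom_phi phiM phi1] := phi_hom.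
  split=> [|U a|U x]; rewrite ?phiA ?phiV //; split=> [i|i j n e U a b|U].
  - have [lp rp] := hom_phi i.
    by split=> [U c x y|U V h x]; rewrite ?lp ?rp.
  - by rewrite phiM.
  - by rewrite phi1.
have phi1E i U (x : L i U) : (phi i U x).1 = x.
  by rewrite -[LHS]/((fun i U x => (phi i U x).1) i U x) fst_phi.
pose d i U (x : L i U) : L (i + 1) U := (phi i U x).2.
have bvd : is_bv_operator S d.
  have [hom_phi phiM phi1] := phi_hom.
  split=> [i|i j n e U a b]; last by rewrite /d phiM /= !phi1E.
  have [lp rp] := hom_phi i.
  by split=> [U c x y|U V h x]; rewrite /d ?lp ?rp.
have d_vec U (x : TA U) : d (-1) U (ext_vec L x) = ext_scal L (nabla U x).
  by rewrite /d phiV.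
have BV : is_BV S (shift_diff d).
  apply: shift_diff_BV => // i U x; apply: bv_square_zero => // {i x}U a b s t.
  rewrite (bv_curv_tens bvd (flat_hom flat) d_vec) (flat_comm flat) [X in ext_scal L X]subrr.
  exact: ext_scal0.
have bE : nabla_of_BV (exist _ _ BV) nabla.
  split=> [|e U x]; first exact: flat_hom flat.
  by rewrite -d_vec (eq_irrelevance e erefl).
exists (exist _ _ BV); split=> // -[d' BV'] [_ nE]; apply: eq_exist => /=.
have bvd' := bv_operator_of_BV BV'.
have -> : d = fun i => d' i (i + 1) erefl; last exact: shift_diffK.
(* For a competing differential [d'], x |-> (x, d' x) is a graded algebra map with the same values
   on generators, so it equals [phi]. *)
have phiE : phi = fun i U x => (x, d' i (i + 1) erefl U x).
  apply: phi_uniq; split=> [|U a|U x]; last 2 first.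
  - by congr (_, _); apply: ext_pos_eq.
  - by congr (_, _); symmetry; apply: nE.
  split=> [i|i j n e U a b|U].
  - have [lp rp] := bvop_hom bvd' i.
    by split=> [U c x y|U V h x] /=; [rewrite lp|rewrite rp].
  - by rewrite /= (bvop_mul bvd').
  - by congr (_, _); apply: ext_pos_eq.
by rewrite /d phiE.
Qed.

End ToBV.
End ExteriorBV.

(** * The bijection *)

Theorem theorem4p10 (k : fieldType) (k_char0 : [pchar k] =i pred0)
    (X : topologicalType) (O : comAlgSheaf k X)
    (X_scheme : is_scheme O) (X_smooth : is_smooth O)
    (T : tangentSheaf O) (DX : diffOps T) (A : dAlgebra DX)
    (TA : tangentOver A) (L : exteriorAlg (tanA_mod TA)) (S : schouten L)
    (DA : diffOpsOver A) :
  [/\ forall c : CYStructure DA,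
        exists! nabla : forall U : opens X, TA U -> A U, nabla_of_CY c nabla,
      forall b : BVStructure S,
        exists! nabla : forall U : opens X, TA U -> A U, nabla_of_BV b nabla,
      forall (c : CYStructure DA) (nabla : forall U : opens X, TA U -> A U),
        nabla_of_CY c nabla -> exists! b : BVStructure S, nabla_of_BV b nabla,
      forall (b : BVStructure S) (nabla : forall U : opens X, TA U -> A U),
        nabla_of_BV b nabla -> exists! c : CYStructure DA, nabla_of_CY c nabla
    & exists (F : CYStructure DA -> BVStructure S) (G : BVStructure S -> CYStructure DA),
      [/\ forall (c : CYStructure DA) (nabla : forall U : opens X, TA U -> A U),
            nabla_of_CY c nabla -> nabla_of_BV (F c) nabla,
          forall (b : BVStructure S) (nabla : forall U : opens X, TA U -> A U),
            nabla_of_BV b nabla -> nabla_of_CY (G b) nabla,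
          cancel F G
        & cancel G F]].
Proof.
have nabla_CY (c : CYStructure DA) (nabla : forall U, TA U -> A U) : nabla_of_CY c nabla -> is_flat_right nabla.
  by move=> [hn nE]; apply: (flat_of_CY (svalP c)).
have nabla_BV (b : BVStructure S) nabla : nabla_of_BV b nabla -> is_flat_right nabla.
  exact: flat_of_BV.
have exCY (c : CYStructure DA) := exists_nabla_of_CY TA c.
have exBV (b : BVStructure S) := exists_nabla_of_BV b.
have toBV (c : CYStructure DA) (nabla : forall U, TA U -> A U) :
    nabla_of_CY c nabla -> exists! b : BVStructure S, nabla_of_BV b nabla.
  by move=> /nabla_CY; apply: exists_BV_of_flat.
have toCY (b : BVStructure S) nabla :
    nabla_of_BV b nabla -> exists! c : CYStructure DA, nabla_of_CY c nabla.
  by move=> /nabla_BV; apply: exists_CY_of_flat.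
split=> //.
(* As [c] has only one [nabla], a [b] chosen for that one serves for all. *)
have /choice [F FP] : forall c : CYStructure DA, exists b : BVStructure S,
    forall nabla : forall U, TA U -> A U, nabla_of_CY c nabla -> nabla_of_BV b nabla.
  move=> c; have [nabla [cn uniq]] := exCY c; have [b [bn _]] := toBV c nabla cn.
  by exists b => nabla' /uniq <-.
have /choice [G GP] : forall b : BVStructure S, exists c : CYStructure DA,
    forall nabla, nabla_of_BV b nabla -> nabla_of_CY c nabla.
  move=> b; have [nabla [bn uniq]] := exBV b; have [c [cn _]] := toCY b nabla bn.
  by exists c => nabla' /uniq <-.
(* A structure and its image under a round trip have the same [nabla], which determines the
   structure. *)
exists F, G; split=> // [c|b].
  have [nabla [cn _]] := exCY c; have bn := FP c nabla cn.
  have [c' [_ uniq]] := toCY (F c) nabla bn.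
  by rewrite -(uniq _ (GP _ _ bn)) -(uniq _ cn).
have [nabla [bn _]] := exBV b; have cn := GP b nabla bn.
have [b' [_ uniq]] := toBV (G b) nabla cn.
by rewrite -(uniq _ (FP _ _ cn)) -(uniq _ bn).
Qed.
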